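(* Let $\mathbf{L}$ be the four-dimensional complex Lie algebra with basis $\{H,A,B,E\}$ and Lie brackets $$[H,E]=2E,\quad [H,A]=\alpha A,\quad [H,B]=\beta B,\quad [E,A]=[E,B]=0,\quad [A,B]=\gamma E,$$ where $\alpha,\beta,\gamma\in\mathbb{C}$ and $\alpha+\beta=2$. Put $\sigma=\tfrac12\ln(1+\gamma E)$. Then the element $$\mathcal{F}=\exp(H\otimes\sigma)\,\exp\left(A\otimes B e^{-2\sigma}\right)$$ is a twist for $\mathcal{U}(\mathbf{L})$, i.e. it is invertible and $$\mathcal{F}_{12}(\Delta\otimes \mathrm{id})(\mathcal{F})=\mathcal{F}_{23}(\mathrm{id}\otimes\Delta)(\mathcal{F}),\qquad (\epsilon\otimes \mathrm{id})(\mathcal{F})=(\mathrm{id}\otimes\epsilon)(\mathcal{F})=1 .$$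
   Context: $\mathcal{U}(\mathbf{L})$ is the universal enveloping algebra with its standard cocommutative Hopf structure: coproduct $\Delta(Y)=Y\otimes1+1\otimes Y$ and counit $\epsilon(Y)=0$ for $Y\in\mathbf{L}$. Subscripts denote the tensor factors in which an element sits: $\mathcal{F}_{12}=\mathcal{F}\otimes 1$, $\mathcal{F}_{23}=1\otimes\mathcal{F}$. Convergence convention: the Lie brackets are homogeneous for the grading $\deg H=0$, $\deg A=\deg B=1$, $\deg E=2$, so $\mathcal{U}(\mathbf{L})^{\otimes n}$ is graded by total degree with degrees in $\mathbb{Z}_{\ge0}$. All expressions (power series for $\ln$, $\exp$) are taken in the completion of $\mathcal{U}(\mathbf{L})^{\otimes n}$ that is the direct product of its homogeneous components; $\Delta$ and $\epsilon$ extend to these completions. *)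

(* Defs.v *)
From HB Require Import structures.
From mathcomp Require Import all_boot all_algebra.
From mathcomp Require Import boolp classical_sets.
From mathcomp Require Import finmap monalg.

Set Implicit Arguments.
Unset Strict Implicit.
Unset Printing Implicit Defensive.

Import GRing.Theory.
Local Open Scope ring_scope.
Local Open Scope quotient_scope.

(* Quotient of a K-module V by the linear span of a set S of vectors. *)
Section ModuleQuotient.
Variables (K : fieldType) (V : lmodType K).

Inductive lspan (S : V -> Prop) : V -> Prop :=
| lspan0 : lspan S 0
| lspanZD (c : K) (v w : V) : S v -> lspan S w -> lspan S (c *: v + w).

Variable S : V -> Prop.

Lemma lspan_mem v : S v -> lspan S v.
Proof. by move=> Sv; have := lspanZD 1 Sv (lspan0 S); rewrite scale1r addr0. Qed.

Lemma lspanD v w : lspan S v -> lspan S w -> lspan S (v + w).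
Proof.
move=> Sv Sw; elim: Sv => [|c x y Sx _ IH]; first by rewrite add0r.
by rewrite -addrA; apply: lspanZD.
Qed.

Lemma lspanZ c v : lspan S v -> lspan S (c *: v).
Proof.
elim=> [|d x y Sx _ IH]; first by rewrite scaler0; exact: lspan0.
by rewrite scalerDr scalerA; apply: lspanZD.
Qed.

Lemma lspanN v : lspan S v -> lspan S (- v).
Proof. by move=> /(lspanZ (-1)); rewrite scaleN1r. Qed.

Definition vequiv (x y : V) : bool := `[< lspan S (x - y) >].

Lemma vequiv_refl : reflexive vequiv.
Proof. by move=> x; apply/asboolP; rewrite subrr; exact: lspan0. Qed.

Lemma vequiv_sym : symmetric vequiv.
Proof. by move=> x y; apply/asboolP/asboolP => /lspanN; rewrite opprB. Qed.

Lemma vequiv_trans : transitive vequiv.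
Proof.
move=> y x z /asboolP xy /asboolP yz; apply/asboolP.
by have := lspanD xy yz; rewrite addrA subrK.
Qed.

Canonical vequiv_rel := EquivRel vequiv vequiv_refl vequiv_sym vequiv_trans.

Definition vquot := {eq_quot vequiv_rel}.
HB.instance Definition _ : EqQuotient V vequiv vquot := EqQuotient.on vquot.
HB.instance Definition _ := Choice.on vquot.

(* The operations on quotients below are locked so that unification never
   unfolds them. *)
Fact vpi_key : unit. Proof. exact: tt. Qed.
Definition vpi : V -> vquot := locked_with vpi_key (fun x => \pi_vquot x).
Fact vrepr_key : unit. Proof. exact: tt. Qed.
Definition vrepr : vquot -> V := locked_with vrepr_key (fun q => repr q).

Lemma vreprK : cancel vrepr vpi.
Proof. by move=> q; rewrite /vpi /vrepr !locked_withE reprK. Qed.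

Lemma vpiP x y : vpi x = vpi y <-> lspan S (x - y).
Proof.
split; first by move/eqP; rewrite /vpi !locked_withE eqquotE => /asboolP.
by move=> h; apply/eqP; rewrite /vpi !locked_withE eqquotE; apply/asboolP.
Qed.

Lemma vrepr_pi x : lspan S (vrepr (vpi x) - x).
Proof. by apply/vpiP; rewrite vreprK. Qed.

Fact vq0_key : unit. Proof. exact: tt. Qed.
Definition vq0 : vquot := locked_with vq0_key (vpi 0).
Fact vqadd_key : unit. Proof. exact: tt. Qed.
Definition vqadd : vquot -> vquot -> vquot :=
  locked_with vqadd_key (fun p q => vpi (vrepr p + vrepr q)).
Fact vqopp_key : unit. Proof. exact: tt. Qed.
Definition vqopp : vquot -> vquot :=
  locked_with vqopp_key (fun p => vpi (- vrepr p)).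
Fact vqscale_key : unit. Proof. exact: tt. Qed.
Definition vqscale : K -> vquot -> vquot :=
  locked_with vqscale_key (fun c p => vpi (c *: vrepr p)).

Lemma vq0E : vq0 = vpi 0.
Proof. by rewrite /vq0 locked_withE. Qed.

Lemma vqaddE x y : vqadd (vpi x) (vpi y) = vpi (x + y).
Proof.
rewrite /vqadd locked_withE; apply/vpiP; rewrite opprD addrACA.
by apply: lspanD; exact: vrepr_pi.
Qed.

Lemma vqoppE x : vqopp (vpi x) = vpi (- x).
Proof.
rewrite /vqopp locked_withE; apply/vpiP; rewrite -opprD.
by apply: lspanN; exact: vrepr_pi.
Qed.

Lemma vqscaleE c x : vqscale c (vpi x) = vpi (c *: x).
Proof.
rewrite /vqscale locked_withE; apply/vpiP; rewrite -scalerBr.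
by apply: lspanZ; exact: vrepr_pi.
Qed.

Lemma vqaddA : associative vqadd.
Proof.
move=> p q r; rewrite -(vreprK p) -(vreprK q) -(vreprK r).
by rewrite !vqaddE addrA.
Qed.

Lemma vqaddC : commutative vqadd.
Proof. by move=> p q; rewrite -(vreprK p) -(vreprK q) !vqaddE addrC. Qed.

Lemma vqadd0 : left_id vq0 vqadd.
Proof. by move=> p; rewrite -(vreprK p) vq0E vqaddE add0r. Qed.

Lemma vqaddN : left_inverse vq0 vqopp vqadd.
Proof. by move=> p; rewrite -(vreprK p) vqoppE vqaddE addNr vq0E. Qed.

HB.instance Definition _ :=
  GRing.isZmodule.Build vquot vqaddA vqaddC vqadd0 vqaddN.

Lemma vpiD x y : vpi (x + y) = vpi x + vpi y.
Proof. by rewrite -vqaddE. Qed.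

Lemma vqscaleA a b p : vqscale a (vqscale b p) = vqscale (a * b) p.
Proof. by rewrite -(vreprK p) !vqscaleE scalerA. Qed.

Lemma vqscale1 : left_id 1 vqscale.
Proof. by move=> p; rewrite -(vreprK p) vqscaleE scale1r. Qed.

Lemma vqscaleDr : right_distributive vqscale +%R.
Proof.
move=> c p q; rewrite -(vreprK p) -(vreprK q) -vpiD !vqscaleE.
by rewrite scalerDr vpiD.
Qed.

Lemma vqscaleDl p : {morph vqscale^~ p : a b / a + b}.
Proof. by move=> a b /=; rewrite -(vreprK p) !vqscaleE scalerDl vpiD. Qed.

HB.instance Definition _ := GRing.Zmodule_isLmodule.Build K vquot
  vqscaleA vqscale1 vqscaleDr vqscaleDl.

Lemma vpi_linear : linear vpi.
Proof. by move=> c x y; rewrite vpiD -vqscaleE. Qed.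
HB.instance Definition _ := GRing.isLinear.Build K V vquot _ vpi vpi_linear.

Lemma vpi0 x : lspan S x -> vpi x = 0.
Proof. by move=> Sx; rewrite -(linear0 vpi); apply/vpiP; rewrite subr0. Qed.

End ModuleQuotient.

(* Linear extension of a map on the basis X of the free module. *)
Section FreeModule.
Variables (K : fieldType) (X : choiceType).

Lemma malgUZ (c : K) (k : X) : << c *g k >> = c *: << k >> :> {malg K[X]}.
Proof. by apply/malgP => i; rewrite mcoeffZ !mcoeffU mulrnAr mulr1. Qed.

Lemma malg_ind (P : {malg K[X]} -> Prop) :
    P 0 -> (forall c k g, P g -> P (c *: << k >> + g)) -> forall g, P g.
Proof.
move=> P0 PD g; rewrite [g]monalgE.
elim: (X in \sum_(k <- X) _) => [|k s IH]; first by rewrite big_nil.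
by rewrite big_cons malgUZ; apply: PD.
Qed.

Variables (V : lmodType K) (h : X -> V).

Definition mlift (g : {malg K[X]}) : V := \sum_(k <- msupp g) g@_k *: h k.

Lemma mliftEw (d : {fset X}) g : fsubset (msupp g) d ->
  mlift g = \sum_(k <- d) g@_k *: h k.
Proof.
move=> le; rewrite [LHS](big_fset_incl _ le) => //= x xd /mcoeff_outdom ->.
by rewrite scale0r.
Qed.

Lemma mlift_linear : linear mlift.
Proof.
move=> c g1 g2; pose d := fsetU (msupp g1) (msupp g2).
have l1 : fsubset (msupp g1) d by exact: fsubsetUl.
have l2 : fsubset (msupp g2) d by exact: fsubsetUr.
have l3 : fsubset (msupp (c *: g1 + g2)) d.
  by apply: (fsubset_trans (msuppD_le _ _)); apply: fsetSU; exact: msuppZ_le.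
rewrite (mliftEw l1) (mliftEw l2) (mliftEw l3) scaler_sumr -big_split /=.
by apply: eq_bigr => k _; rewrite mcoeffD mcoeffZ scalerDl scalerA.
Qed.
HB.instance Definition _ :=
  GRing.isLinear.Build K {malg K[X]} V _ mlift mlift_linear.

Lemma mliftU k : mlift << k >> = h k.
Proof.
by rewrite (mliftEw msuppU_le) big_seq_fset1 mcoeffUU scale1r.
Qed.

End FreeModule.
Arguments mlift {K X V} h g.

(* Tensor product of modules: the free module on A * B modulo bilinearity. *)
Section TensorProduct.
Variables (K : fieldType) (A B : lmodType K).

Inductive bilin_rel : {malg K[(A * B)%type]} -> Prop :=
| bilin_rell c a a' b :
    bilin_rel (<< (c *: a + a', b) >> - (c *: << (a, b) >> + << (a', b) >>))
| bilin_relr c a b b' :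
    bilin_rel (<< (a, c *: b + b') >> - (c *: << (a, b) >> + << (a, b') >>)).

Definition tensor := vquot bilin_rel.
HB.instance Definition _ := GRing.Lmodule.on tensor.

Fact tens_key : unit. Proof. exact: tt. Qed.
Definition tens : A -> B -> tensor :=
  locked_with tens_key (fun a b => vpi bilin_rel << (a, b) >>).

Lemma tensE a b : tens a b = vpi bilin_rel << (a, b) >>.
Proof. by rewrite /tens locked_withE. Qed.

Lemma tens_linearl b : linear (tens^~ b).
Proof.
move=> c a a'; rewrite !tensE -vpi_linear.
by apply/vpiP; apply: lspan_mem; exact: bilin_rell.
Qed.

Lemma tens_linearr a : linear (tens a).
Proof.
move=> c b b'; rewrite !tensE -vpi_linear.
by apply/vpiP; apply: lspan_mem; exact: bilin_relr.
Qed.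

Lemma tens_ind (P : tensor -> Prop) :
    P 0 -> (forall c a b t, P t -> P (c *: tens a b + t)) -> forall t, P t.
Proof.
move=> P0 PD t; rewrite -(vreprK t); elim/malg_ind: (vrepr t).
  by rewrite linear0.
by move=> c [a b] g; rewrite vpi_linear -tensE; exact: PD.
Qed.

Definition bilin (C : lmodType K) (f : A -> B -> C) : Prop :=
  (forall b, linear (f^~ b)) /\ (forall a, linear (f a)).

(* The linear map on the tensor product induced by a bilinear map. *)
Fact tlift_key : unit. Proof. exact: tt. Qed.
Definition tlift (C : lmodType K) : (A -> B -> C) -> tensor -> C :=
  locked_with tlift_key (fun f t => mlift (fun p => f p.1 p.2) (vrepr t)).

Lemma tlift_def (C : lmodType K) (f : A -> B -> C) t :
  tlift f t = mlift (fun p => f p.1 p.2) (vrepr t).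
Proof. by rewrite /tlift locked_withE. Qed.

Section Lift.
Variables (C : lmodType K) (f : A -> B -> C) (bf : bilin f).

Lemma tlift_pi g : tlift f (vpi bilin_rel g) = mlift (fun p => f p.1 p.2) g.
Proof.
apply/eqP; rewrite -subr_eq0 tlift_def -raddfB /=; apply/eqP.
elim: (vrepr_pi bilin_rel g) => [|c v w Sv _ IH]; first exact: linear0.
rewrite mlift_linear IH addr0.
suff -> : mlift (fun p : (A * B)%type => f p.1 p.2) v = 0 by rewrite scaler0.
case: Sv => {c} [c a a' b|c a b b']; rewrite linearB /= mlift_linear !mliftU /=.
  by rewrite (bf.1 b) subrr.
by rewrite (bf.2 a) subrr.
Qed.

Lemma tlift_linear : linear (tlift f).
Proof.
move=> c s t; rewrite -(vreprK s) -(vreprK t) -vpi_linear !tlift_pi.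
exact: mlift_linear.
Qed.

Lemma tliftE a b : tlift f (tens a b) = f a b.
Proof. by rewrite tensE tlift_pi mliftU. Qed.

End Lift.

Lemma tlift_comb (C : lmodType K) (f g h : A -> B -> C) c t :
    (forall a b, f a b = c *: g a b + h a b) ->
  tlift f t = c *: tlift g t + tlift h t.
Proof.
move=> e; rewrite !tlift_def /mlift scaler_sumr -big_split /=.
by apply: eq_bigr => p _; rewrite e scalerDr !scalerA mulrC.
Qed.

Lemma tlift_ext (C : lmodType K) (f g : A -> B -> C) t :
  (forall a b, f a b = g a b) -> tlift f t = tlift g t.
Proof. by move=> e; rewrite !tlift_def; apply: eq_bigr => p _; rewrite e. Qed.

End TensorProduct.
Arguments tens {K A B} a b.
Arguments tlift {K A B C} f t.

(* Every nonzero vector is detected by a linear form; needed for 1 <> 0 in a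
   tensor product of algebras. *)
Section LinearForm.
Variables (K : fieldType) (V : lmodType K).
Local Open Scope classical_set_scope.

Lemma linear_form (v : V) : v <> 0 ->
  exists f : V -> K^o, linear f /\ f v = 1.
Proof.
move=> v0.
pose lin (W : set V) := forall c x y, W x -> W y -> W (c *: x + y).
have [F FP Ftot|W [[Wlin Wv] Wmax]] :=
    @Zorn_bigcup V [set W : set V | lin W /\ ~ W v].
  split=> [c x y [X FX Xx] [Y FY Yy]|[X FX Xv]]; last by case: (FP _ FX).
  have [XY|YX] := Ftot _ _ FX FY.
    by exists Y => //; apply: (FP _ FY).1 => //; exact: XY.
  by exists X => //; apply: (FP _ FX).1 => //; exact: YX.
have W0 : W 0.
  apply: contrapT => nW0.
  have W_0 x : ~ W x by move=> Wx; apply: nW0; rewrite -(addNr x) -scaleN1r; exact: Wlin.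
  apply: (Wmax [set 0]); first by split=> [x /W_0//|/(_ 0 erefl)].
  by split=> [c x y -> ->|]; [rewrite /set1 /= scaler0 addr0 | exact: v0].
have WZ c x : W x -> W (c *: x) by move=> Wx; rewrite -[c *: x]addr0; exact: Wlin.
have WD x y : W x -> W y -> W (x + y) by move=> Wx; rewrite -[x]scale1r; exact: Wlin.
have decomp x : exists c, W (x - c *: v).
  have [Wx|nWx] := pselect (W x); first by exists 0; rewrite scale0r subr0.
  pose W' := [set w + d *: x | w in W & d in [set: K]].
  have W'v : W' v.
    apply: contrapT => nW'v; apply: (Wmax W').
      split=> [w Ww|/(_ x) W'W]; first by exists w => //; exists 0 => //; rewrite scale0r addr0.
      by apply: nWx; apply: W'W; exists 0 => //; exists 1 => //; rewrite scale1r add0r.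
    split=> // c _ _ [w Ww [d _ <-]] [w' Ww' [d' _ <-]].
    exists (c *: w + w'); first exact: Wlin.
    by exists (c * d + d') => //; rewrite scalerDr scalerDl scalerA addrACA.
  case: W'v => w Ww [d _ wv].
  have d0 : d != 0.
    by apply/eqP => d0; apply: Wv; rewrite -wv d0 scale0r addr0.
  exists d^-1; rewrite -wv scalerDr scalerA mulVf // scale1r opprD addrC subrK.
  by rewrite -scaleNr; exact: WZ.
have uniq x c c' : W (x - c *: v) -> W (x - c' *: v) -> c = c'.
  move=> h h'; apply/eqP; rewrite -subr_eq0; apply/eqP; apply: contrapT => /eqP e0.
  have := WD _ _ h' (WZ (-1) _ h); rewrite scaleN1r opprB addrC addrA subrK.
  rewrite -scalerBl => /(WZ (c - c')^-1); rewrite scalerA mulVf //.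
  by rewrite scale1r.
pose f (x : V) : K^o := projT1 (cid (decomp x)).
have fP x : W (x - f x *: v) by rewrite /f; case: cid.
exists f; split.
  move=> c x y; apply: (uniq (c *: x + y)); first exact: fP.
  have := WD _ _ (WZ c _ (fP x)) (fP y).
  by rewrite scalerBr scalerA addrACA -opprD -scalerDl.
by apply: (uniq v); [exact: fP | rewrite scale1r subrr].
Qed.

End LinearForm.

(* A tensor product of algebras is an algebra for
   (a (x) b) (a' (x) b') = a a' (x) b b'. *)
Section TensorAlgebra.
Variables (K : fieldType) (A B : algType K).
Local Notation T := (tensor A B).

Definition tmulr (t : T) (a : A) (b : B) : T :=
  tlift (fun a' b' => tens (a * a') (b * b')) t.

Fact tmul_key : unit. Proof. exact: tt. Qed.
Definition tmul : T -> T -> T :=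
  locked_with tmul_key (fun s t => tlift (tmulr t) s).

Lemma tmul_def s t : tmul s t = tlift (tmulr t) s.
Proof. by rewrite /tmul locked_withE. Qed.

Lemma tmulr_bilin0 a b :
  bilin (fun (a' : A) (b' : B) => tens (a * a') (b * b')).
Proof.
split=> [b' c x y|a' c x y] /=; first by rewrite mulrDr -scalerAr tens_linearl.
by rewrite mulrDr -scalerAr tens_linearr.
Qed.

Lemma tmulr_bilin t : bilin (tmulr t).
Proof.
split=> [b c x y|a c x y]; apply: tlift_comb => a' b'.
  by rewrite mulrDl -scalerAl tens_linearl.
by rewrite mulrDl -scalerAl tens_linearr.
Qed.

Lemma tmul_linearl t : linear (tmul^~ t).
Proof. by move=> c x y; rewrite !tmul_def; exact/tlift_linear/tmulr_bilin. Qed.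

Lemma tmul_linearr s : linear (tmul s).
Proof.
move=> c t t'; rewrite !tmul_def; apply: tlift_comb => a b.
exact/tlift_linear/tmulr_bilin0.
Qed.

Lemma tmulE a b a' b' : tmul (tens a b) (tens a' b') = tens (a * a') (b * b').
Proof. by rewrite tmul_def (tliftE (tmulr_bilin _)) /tmulr (tliftE (tmulr_bilin0 _ _)). Qed.

Lemma linear_zero (U V : lmodType K) (f : U -> V) : linear f -> f 0 = 0.
Proof. by move=> lf; have := lf (-1) 0 0; rewrite scaler0 addr0 scaleN1r addNr. Qed.

Lemma tmulA : associative tmul.
Proof.
have l0 t : tmul 0 t = 0 by exact: (linear_zero (tmul_linearl t)).
have r0 s : tmul s 0 = 0 by exact: (linear_zero (tmul_linearr s)).
have lD := tmul_linearl; have rD := tmul_linearr.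
move=> s t u; elim/tens_ind: s => [|c a b s IHs]; first by rewrite !l0.
rewrite 3!lD IHs.
suff -> : tmul (tens a b) (tmul t u) = tmul (tmul (tens a b) t) u by [].
elim/tens_ind: t {s IHs} => [|d a' b' t IHt]; first by rewrite r0 !l0 r0.
rewrite lD 2!rD lD IHt.
suff -> : tmul (tens a b) (tmul (tens a' b') u) =
          tmul (tmul (tens a b) (tens a' b')) u by [].
elim/tens_ind: u {t IHt} => [|e a1 b1 u IHu]; first by rewrite !r0.
by rewrite 3!rD IHu !tmulE !mulrA.
Qed.

Lemma tmul1l : left_id (tens 1 1) tmul.
Proof.
move=> t; elim/tens_ind: t => [|c a b t IH].
  exact: (linear_zero (tmul_linearr _)).
by rewrite tmul_linearr IH tmulE !mul1r.
Qed.

Lemma tmul1r : right_id (tens 1 1) tmul.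
Proof.
move=> t; elim/tens_ind: t => [|c a b t IH].
  exact: (linear_zero (tmul_linearl _)).
by rewrite tmul_linearl IH tmulE !mulr1.
Qed.

Lemma tmulDl : left_distributive tmul +%R.
Proof. by move=> s s' t; rewrite -[s]scale1r tmul_linearl !scale1r. Qed.

Lemma tmulDr : right_distributive tmul +%R.
Proof. by move=> s t t'; rewrite -[t]scale1r tmul_linearr !scale1r. Qed.

Lemma tone_neq0 : tens 1 1 != 0 :> T.
Proof.
have [f [fl f1]] : exists f : A -> K^o, linear f /\ f 1 = 1.
  by apply: linear_form; apply/eqP; exact: oner_neq0.
have [g [gl g1]] : exists g : B -> K^o, linear g /\ g 1 = 1.
  by apply: linear_form; apply/eqP; exact: oner_neq0.
have bfg : bilin (fun a b => f a * g b : K^o).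
  split=> [b c x y|a c x y] /=; first by rewrite fl mulrDl -scalerAl.
  by rewrite gl mulrDr -scalerAr.
apply/eqP => /(congr1 (tlift (fun a b => f a * g b : K^o))).
rewrite (tliftE bfg) (linear_zero (tlift_linear bfg)) f1 g1 mulr1.
by apply/eqP; exact: oner_neq0.
Qed.

HB.instance Definition _ := GRing.Zmodule_isNzRing.Build T
  tmulA tmul1l tmul1r tmulDl tmulDr tone_neq0.

Lemma tens1 : tens 1 1 = 1 :> T. Proof. by []. Qed.

Lemma tensM (a a' : A) (b b' : B) :
  tens a b * tens a' b' = tens (a * a') (b * b').
Proof. exact: tmulE. Qed.

Lemma tscalerAl c (s t : T) : c *: (s * t) = c *: s * t.
Proof.
have := tmul_linearl t c s 0.
by rewrite (linear_zero (tmul_linearl t)) !addr0.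
Qed.
HB.instance Definition _ := GRing.Lmodule_isLalgebra.Build K T tscalerAl.

Lemma tscalerAr c (s t : T) : c *: (s * t) = s * (c *: t).
Proof.
have := tmul_linearr s c t 0.
by rewrite (linear_zero (tmul_linearr s)) !addr0.
Qed.
HB.instance Definition _ := GRing.Lalgebra_isAlgebra.Build K T tscalerAr.

End TensorAlgebra.

Section TensorMaps.
Variable K : fieldType.

Section Tmap.
Variables (A A' B B' : lmodType K).
Variables (f : {linear A -> A'}) (g : {linear B -> B'}).

Definition tmap : tensor A B -> tensor A' B' :=
  tlift (fun a b => tens (f a) (g b)).

Lemma tmap_bilin : bilin (fun a b => tens (f a) (g b)).
Proof.
split=> [b c x y|a c x y] /=; first by rewrite linearP tens_linearl.
by rewrite linearP tens_linearr.
Qed.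

Lemma tmap_linear : linear tmap.
Proof. exact/tlift_linear/tmap_bilin. Qed.
HB.instance Definition _ := GRing.isLinear.Build K _ _ _ tmap tmap_linear.

Lemma tmapE a b : tmap (tens a b) = tens (f a) (g b).
Proof. exact/(tliftE tmap_bilin). Qed.

End Tmap.

(* The canonical identification of A (x) (B (x) C) with (A (x) B) (x) C. *)
Section Tassoc.
Variables (A B C : lmodType K).

Definition tassoc : tensor A (tensor B C) -> tensor (tensor A B) C :=
  tlift (fun a => tlift (fun b c => tens (tens a b) c)).

Lemma tassoc_bilin0 (a : A) :
  bilin (fun (b : B) (c : C) => tens (tens a b) c).
Proof.
split=> [b c x y|b c x y] /=; first by rewrite tens_linearr tens_linearl.
by rewrite tens_linearr.
Qed.

Lemma tassoc_bilin :
  bilin (fun (a : A) (t : tensor B C) =>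
    tlift (fun (b : B) (c : C) => tens (tens a b) c) t).
Proof.
split=> [t c x y|a] /=.
  by apply: tlift_comb => b d; rewrite !tens_linearl.
exact/tlift_linear/tassoc_bilin0.
Qed.

Lemma tassoc_linear : linear tassoc.
Proof. exact/tlift_linear/tassoc_bilin. Qed.
HB.instance Definition _ := GRing.isLinear.Build K _ _ _ tassoc tassoc_linear.

Lemma tassocE a b c : tassoc (tens a (tens b c)) = tens (tens a b) c.
Proof.
by rewrite /tassoc (tliftE tassoc_bilin) (tliftE (tassoc_bilin0 _)).
Qed.

End Tassoc.

(* The canonical identifications of K (x) A and A (x) K with A. *)
Section Tunit.
Variable A : lmodType K.

Definition tunitl : tensor K^o A -> A := tlift (fun (c : K^o) a => c *: a).
Definition tunitr : tensor A K^o -> A := tlift (fun a (c : K^o) => c *: a).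

Lemma tunitl_bilin : bilin (fun (c : K^o) (a : A) => c *: a).
Proof.
split=> [a c x y|c d x y] /=; first by rewrite scalerDl scalerA.
by rewrite scalerDr !scalerA mulrC.
Qed.

Lemma tunitr_bilin : bilin (fun (a : A) (c : K^o) => c *: a).
Proof. by split; [exact: tunitl_bilin.2 | exact: tunitl_bilin.1]. Qed.

Lemma tunitl_linear : linear tunitl.
Proof. exact/tlift_linear/tunitl_bilin. Qed.
HB.instance Definition _ := GRing.isLinear.Build K _ _ _ tunitl tunitl_linear.

Lemma tunitr_linear : linear tunitr.
Proof. exact/tlift_linear/tunitr_bilin. Qed.
HB.instance Definition _ := GRing.isLinear.Build K _ _ _ tunitr tunitr_linear.

Lemma tunitlE c a : tunitl (tens c a) = c *: a.
Proof. exact/(tliftE tunitl_bilin). Qed.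

Lemma tunitrE a c : tunitr (tens a c) = c *: a.
Proof. exact/(tliftE tunitr_bilin). Qed.

End Tunit.
End TensorMaps.

HB.mixin Record Lmodule_isLie (K : fieldType) L of GRing.Lmodule K L := {
  lie : L -> L -> L;
  lie_linearl : forall y, linear (lie^~ y);
  lie_linearr : forall x, linear (lie x);
  liexx : forall x, lie x x = 0;
  lie_jacobi : forall x y z,
    lie x (lie y z) + lie y (lie z x) + lie z (lie x y) = 0
}.

#[short(type="lieType")]
HB.structure Definition Lie (K : fieldType) :=
  { L of Lmodule_isLie K L & GRing.Lmodule K L }.

#[short(type="finLieType")]
HB.structure Definition FinLie (K : fieldType) :=
  { L of Lie K L & Vector K L }.

(* Quotient of an associative algebra by the two-sided ideal generated by S. *)
Section IdealQuotient.
Variables (K : fieldType) (F : algType K) (S : F -> Prop).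

Definition ideal_gen (v : F) : Prop :=
  exists a r b : F, S r /\ v = a * r * b.

Definition aquot := vquot ideal_gen.
HB.instance Definition _ := GRing.Lmodule.on aquot.

Local Notation pi := (vpi ideal_gen).

Fact amul_key : unit. Proof. exact: tt. Qed.
Definition amul : aquot -> aquot -> aquot :=
  locked_with amul_key (fun u v => pi (vrepr u * vrepr v)).

Lemma ideal_gen_mem r : S r -> lspan ideal_gen r.
Proof. by move=> Sr; apply: lspan_mem; exists 1, r, 1; rewrite mul1r mulr1. Qed.

Lemma ideall x v : lspan ideal_gen v -> lspan ideal_gen (x * v).
Proof.
elim=> [|c y z [a [r [b [Rr ->]]]] _ IH]; first by rewrite mulr0; exact: lspan0.
rewrite mulrDr -scalerAr; apply: lspanZD => //.
by exists (x * a), r, b; rewrite !mulrA.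
Qed.

Lemma idealr x v : lspan ideal_gen v -> lspan ideal_gen (v * x).
Proof.
elim=> [|c y z [a [r [b [Rr ->]]]] _ IH]; first by rewrite mul0r; exact: lspan0.
rewrite mulrDl -scalerAl; apply: lspanZD => //.
by exists a, r, (b * x); rewrite !mulrA.
Qed.

Lemma amulE x y : amul (pi x) (pi y) = pi (x * y).
Proof.
rewrite /amul locked_withE; apply/vpiP.
set x' := vrepr _; set y' := vrepr _.
have -> : x' * y' - x * y = (x' - x) * y' + x * (y' - y).
  by rewrite mulrBl mulrBr addrA subrK.
by apply: lspanD; [apply: idealr | apply: ideall]; exact: vrepr_pi.
Qed.

Lemma amulA : associative amul.
Proof.
by move=> u v w; rewrite -(vreprK u) -(vreprK v) -(vreprK w) !amulE mulrA.
Qed.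

Lemma amul1l : left_id (pi 1) amul.
Proof. by move=> u; rewrite -(vreprK u) amulE mul1r. Qed.

Lemma amul1r : right_id (pi 1) amul.
Proof. by move=> u; rewrite -(vreprK u) amulE mulr1. Qed.

Lemma amulDl : left_distributive amul +%R.
Proof.
move=> u v w; rewrite -(vreprK u) -(vreprK v) -(vreprK w) -vpiD !amulE.
by rewrite mulrDl vpiD.
Qed.

Lemma amulDr : right_distributive amul +%R.
Proof.
move=> u v w; rewrite -(vreprK u) -(vreprK v) -(vreprK w) -vpiD !amulE.
by rewrite mulrDr vpiD.
Qed.

Lemma ascalerAl c u v : c *: amul u v = amul (c *: u) v.
Proof.
by rewrite -(vreprK u) -(vreprK v) amulE -!linearZ amulE scalerAl.
Qed.

Lemma ascalerAr c u v : c *: amul u v = amul u (c *: v).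
Proof.
by rewrite -(vreprK u) -(vreprK v) amulE -!linearZ amulE scalerAr.
Qed.

Section Lift.
Variables (C : algType K) (g : F -> C).
Hypotheses (gl : linear g) (gm : monoid_morphism g).
Hypothesis g0 : forall r, S r -> g r = 0.

Fact alift_key : unit. Proof. exact: tt. Qed.
Definition alift : aquot -> C := locked_with alift_key (fun u => g (vrepr u)).

Lemma alift_pi x : alift (pi x) = g x.
Proof.
rewrite /alift locked_withE -[vrepr _](subrK x).
suff E v : lspan ideal_gen v -> g v = 0.
  by rewrite -[_ - _]scale1r gl E ?scaler0 ?add0r //; exact: vrepr_pi.
elim=> [|c y z [a [r [b [Rr ->]]]] _ IH]; first exact: linear_zero.
by rewrite gl IH addr0 !gm.2 (g0 Rr) mulr0 mul0r scaler0.
Qed.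

Lemma alift_linear : linear alift.
Proof.
by move=> c u v; rewrite -(vreprK u) -(vreprK v) -vpi_linear !alift_pi gl.
Qed.

Lemma alift_mul u v : alift (amul u v) = alift u * alift v.
Proof. by rewrite -(vreprK u) -(vreprK v) amulE !alift_pi gm.2. Qed.

Lemma alift_one : alift (pi 1) = 1.
Proof. by rewrite alift_pi gm.1. Qed.

End Lift.
End IdealQuotient.

(* The free associative unital algebra on the set X. *)
Section FreeAlgebra.
Variables (K : fieldType) (X : choiceType).

Definition freealg := {malg K[{fmonom X}]}.
HB.instance Definition _ := GRing.Lmodule.on freealg.

Fact free_mul_key : unit. Proof. exact: tt. Qed.
Definition free_mul : freealg -> freealg -> freealg :=
  locked_with free_mul_key (@fgmul {fmonom X} K).

Lemma free_mulE : free_mul = @fgmul {fmonom X} K.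
Proof. by rewrite /free_mul locked_withE. Qed.

Lemma free_mulA : associative free_mul.
Proof. by rewrite free_mulE; exact: fgmulA. Qed.
Lemma free_mul1l : left_id << mone >> free_mul.
Proof. by rewrite free_mulE; exact: fgmul1g. Qed.
Lemma free_mul1r : right_id << mone >> free_mul.
Proof. by rewrite free_mulE; exact: fgmulg1. Qed.
Lemma free_mulDl : left_distributive free_mul +%R.
Proof. by rewrite free_mulE; exact: fgmulgDl. Qed.
Lemma free_mulDr : right_distributive free_mul +%R.
Proof. by rewrite free_mulE; exact: fgmulgDr. Qed.
Lemma free_one_neq0 : << mone >> != 0 :> freealg.
Proof. exact: fgoner_eq0. Qed.

HB.instance Definition _ := GRing.Zmodule_isNzRing.Build freealg
  free_mulA free_mul1l free_mul1r free_mulDl free_mulDr free_one_neq0.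

Lemma free_scalerAl (c : K) (x y : freealg) :
  c *: (x * y) = (c *: x : freealg) * y.
Proof.
change (c *: free_mul x y = free_mul (c *: x) y); rewrite free_mulE.
exact: fgscaleAl.
Qed.
HB.instance Definition _ :=
  GRing.Lmodule_isLalgebra.Build K freealg free_scalerAl.

Lemma free_scalerAr (c : K) (x y : freealg) :
  c *: (x * y) = x * (c *: y : freealg).
Proof.
change (c *: free_mul x y = free_mul x (c *: y)); rewrite free_mulE.
apply/malgP => k; transitivity (c * (fgmul x y)@_k); first exact: mcoeffZ.
transitivity (\sum_(k1 <- msupp x) \sum_(k2 <- msupp y)
    (x@_k1 * (c *: y)@_k2) *+ (mmul k1 k2 == k)); last first.
  by apply/esym/mcoeffMlw; [exact: fsubset_refl | exact: msuppZ_le].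
rewrite (mcoeffMl x y k) mulr_sumr; apply: eq_bigr => k1 _.
rewrite mulr_sumr; apply: eq_bigr => k2 _.
have -> : (c *: y)@_k2 = c * y@_k2 by exact: mcoeffZ.
by rewrite mulrnAr mulrCA.
Qed.
HB.instance Definition _ :=
  GRing.Lalgebra_isAlgebra.Build K freealg free_scalerAr.

(* The basis element of the free algebra given by a word. *)
Fact word_key : unit. Proof. exact: tt. Qed.
Definition word : {fmonom X} -> freealg :=
  locked_with word_key (fun m => << m >>).
Definition letter (x : X) : freealg := word (fmu x).

Lemma wordE m : word m = << m >>.
Proof. by rewrite /word locked_withE. Qed.

Lemma word1 : word mone = 1.
Proof. by rewrite wordE. Qed.

Lemma wordM (m n : {fmonom X}) : word (mmul m n) = word m * word n.
Proof.
change (word (mmul m n) = free_mul (word m) (word n)).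
by rewrite !wordE free_mulE -[1 in LHS](mulr1 1); apply/esym/fgmulUU.
Qed.

Lemma free_ind (P : freealg -> Prop) :
    P 0 -> (forall (c : K) m g, P g -> P (c *: word m + g)) ->
  forall g, P g.
Proof.
move=> P0 PD; apply: malg_ind; first exact: P0.
by move=> c k g; rewrite -wordE; exact: PD.
Qed.

Variables (C : algType K) (f : X -> C).

Definition word_ext (m : {fmonom X}) : C := \prod_(x <- (m : seq X)) f x.

(* The algebra morphism extending f. *)
Fact free_ext_key : unit. Proof. exact: tt. Qed.
Definition free_ext : freealg -> C :=
  locked_with free_ext_key (mlift word_ext).

Lemma free_extU m : free_ext (word m) = word_ext m.
Proof. by rewrite /free_ext locked_withE wordE mliftU. Qed.

Lemma free_ext_linear : linear free_ext.
Proof. by rewrite /free_ext locked_withE; exact: mlift_linear. Qed.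

Lemma word_extM m n : word_ext (mmul m n) = word_ext m * word_ext n.
Proof. by rewrite /word_ext fmM big_cat. Qed.

Lemma free_extM x y : free_ext (x * y) = free_ext x * free_ext y.
Proof.
have l0 : free_ext 0 = 0 by exact: (linear_zero free_ext_linear).
move: x; apply: free_ind => [|c m g IH]; first by rewrite mul0r l0 mul0r.
rewrite mulrDl -scalerAl 2!free_ext_linear IH mulrDl -scalerAl.
suff -> : free_ext (word m * y) = free_ext (word m) * free_ext y by [].
move: y {IH}; apply: free_ind => [|d n h IH]; first by rewrite mulr0 l0 mulr0.
rewrite mulrDr -scalerAr 2!free_ext_linear IH mulrDr -scalerAr.
by rewrite -wordM !free_extU word_extM.
Qed.

Lemma free_ext_monoid : monoid_morphism free_ext.
Proof.
split; last exact: free_extM.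
by rewrite -word1 free_extU /word_ext fm1 big_nil.
Qed.

Lemma free_ext_letter x : free_ext (letter x) = f x.
Proof. by rewrite free_extU /word_ext fmU big_seq1. Qed.

End FreeAlgebra.
Arguments letter K {X} x.

(* The universal enveloping algebra: the free associative unital algebra on the
   set L, modulo the two-sided ideal generated by the relations expressing that
   L -> U(L) is linear and that x y - y x = [x, y]. *)
Section Enveloping.
Variables (K : fieldType) (L : lieType K).
Local Notation "''l_' x" := (letter K x) (at level 8, x at level 2).

Inductive uenv_rel : freealg K L -> Prop :=
| uenv_rel_linear (c : K) (x y : L) :
    uenv_rel ('l_(c *: x + y) - (c *: 'l_x + 'l_y))
| uenv_rel_lie (x y : L) :
    uenv_rel ('l_x * 'l_y - 'l_y * 'l_x - 'l_(lie x y)).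

Definition Uenv := aquot uenv_rel.
HB.instance Definition _ := GRing.Lmodule.on Uenv.

Local Notation pi := (vpi (ideal_gen uenv_rel)).
Local Notation umul := (@amul K (freealg K L) uenv_rel).

(* The algebra morphism U(L) -> C extending a Lie algebra morphism f. *)
Definition uext (C : algType K) (f : L -> C) : Uenv -> C := alift (free_ext f).

Definition lie_morphism (C : algType K) (f : L -> C) : Prop :=
  linear f /\ forall x y, f (lie x y) = f x * f y - f y * f x.

Lemma uenv_rel_ext (C : algType K) (f : L -> C) :
  lie_morphism f -> forall r, uenv_rel r -> free_ext f r = 0.
Proof.
move=> lf r.
have B u v : free_ext f (u - v) = free_ext f u - free_ext f v.
  by rewrite -[- v]scaleN1r addrC (free_ext_linear f) scaleN1r addrC.
case=> [d u v|u v]; rewrite !B.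
  by rewrite free_ext_linear !free_ext_letter lf.1 subrr.
by rewrite !free_extM !free_ext_letter lf.2 subrr.
Qed.

Lemma lie_morphism0 : lie_morphism (fun _ : L => 0 : K^o).
Proof.
by split=> [c x y|x y]; rewrite ?scaler0 ?addr0 // !mul0r subr0.
Qed.

Lemma uone_neq0 : pi 1 != 0 :> Uenv.
Proof.
have g0 := uenv_rel_ext lie_morphism0.
have gl := free_ext_linear (fun _ : L => 0 : K^o).
have gm := free_ext_monoid (fun _ : L => 0 : K^o).
apply/eqP => /(congr1 (alift (free_ext (fun _ : L => 0 : K^o)))).
rewrite (alift_one gl gm g0) (linear_zero (alift_linear gl gm g0)).
by apply/eqP; exact: oner_neq0.
Qed.

HB.instance Definition _ := GRing.Zmodule_isNzRing.Build Uenv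
  (@amulA _ _ _) (@amul1l _ _ _) (@amul1r _ _ _) (@amulDl _ _ _)
  (@amulDr _ _ _) uone_neq0.
HB.instance Definition _ := GRing.Lmodule_isLalgebra.Build K Uenv
  (@ascalerAl _ _ _).
HB.instance Definition _ := GRing.Lalgebra_isAlgebra.Build K Uenv
  (@ascalerAr _ _ _).

Lemma piM x y : pi (x * y) = (pi x : Uenv) * pi y.
Proof. by rewrite -amulE. Qed.

Fact uinj_key : unit. Proof. exact: tt. Qed.
Definition uinj : L -> Uenv := locked_with uinj_key (fun x => pi 'l_x).

Lemma uinjE x : uinj x = pi 'l_x.
Proof. by rewrite /uinj locked_withE. Qed.

Lemma uinj_linear : linear uinj.
Proof.
move=> c x y; rewrite !uinjE -vpi_linear; apply/vpiP.
exact/ideal_gen_mem/uenv_rel_linear.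
Qed.
HB.instance Definition _ := GRing.isLinear.Build K L Uenv _ uinj uinj_linear.

Lemma uinj_lie x y : uinj (lie x y) = uinj x * uinj y - uinj y * uinj x.
Proof.
rewrite !uinjE -!piM -[X in _ = _ + X]scaleN1r addrC -vpi_linear.
rewrite scaleN1r addrC; apply/esym/vpiP.
exact/ideal_gen_mem/uenv_rel_lie.
Qed.

Lemma uenv_ind (P : Uenv -> Prop) :
    P 0 -> P 1 -> (forall c u v, P u -> P v -> P (c *: u + v)) ->
    (forall x u, P u -> P (uinj x * u)) ->
  forall u, P u.
Proof.
move=> P0 P1 PD PM u; rewrite -(vreprK u); move: (vrepr u).
apply: free_ind => [|c m g Pg]; first by rewrite linear0.
rewrite vpi_linear; apply: PD => // {c g Pg}.
case: m => s; elim: s => [|x s IH]; first by rewrite -fmoneE word1.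
have -> : FMonom (x :: s) = mmul (fmu x) (FMonom s).
  by apply/eqP; rewrite fmP fmM fmU.
by rewrite wordM piM -uinjE; exact: PM.
Qed.

Section Extension.
Variables (C : algType K) (f : L -> C).
Hypothesis lf : lie_morphism f.

Lemma uext_linear : linear (uext f).
Proof.
exact: (alift_linear (free_ext_linear f) (free_ext_monoid f) (uenv_rel_ext lf)).
Qed.

Lemma uext_monoid : monoid_morphism (uext f).
Proof.
pose gl := free_ext_linear f; pose gm := free_ext_monoid f.
split; first exact: (alift_one gl gm (uenv_rel_ext lf)).
exact: (alift_mul gl gm (uenv_rel_ext lf)).
Qed.

Lemma uext_inj x : uext f (uinj x) = f x.
Proof.
rewrite uinjE /uext.
rewrite (alift_pi (free_ext_linear f) (free_ext_monoid f) (uenv_rel_ext lf)).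
exact: free_ext_letter.
Qed.

End Extension.
End Enveloping.
Arguments Uenv {K} L.

Section Coproduct.
Variables (K : fieldType) (L : lieType K).
Local Notation U := (Uenv L).

Definition primitive (x : L) : tensor U U := tens (uinj x) 1 + tens 1 (uinj x).

Lemma primitive_lie : lie_morphism primitive.
Proof.
split=> [c x y|x y]; rewrite /primitive.
  by rewrite linearP tens_linearl tens_linearr /= scalerDr addrACA.
have tBl (a a' b : U) : tens (a - a') b = tens a b - tens a' b.
  by rewrite addrC -scaleN1r tens_linearl scaleN1r addrC.
have tBr (a b b' : U) : tens a (b - b') = tens a b - tens a b'.
  by rewrite addrC -scaleN1r tens_linearr scaleN1r addrC.
have E (u v : U) : (tens u 1 + tens 1 u) * (tens v 1 + tens 1 v) =
    tens (u * v) 1 + tens 1 (u * v) + (tens u v + tens v u).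
  rewrite mulrDl !mulrDr !tensM !mul1r !mulr1.
  by rewrite (addrC (tens v u)) addrACA.
rewrite uinj_lie tBl tBr !E (addrC (tens (uinj y) (uinj x))).
set m := _ + tens (uinj y) _; set a := tens _ 1; set a' := tens _ 1.
set b := tens 1 _; set b' := tens 1 _.
by rewrite opprD [RHS]addrACA subrr addr0 opprD addrACA.
Qed.

Definition coproduct : U -> tensor U U := uext primitive.

Lemma coproduct_linear : linear coproduct.
Proof. exact/uext_linear/primitive_lie. Qed.
HB.instance Definition _ :=
  GRing.isLinear.Build K U (tensor U U) _ coproduct coproduct_linear.

Lemma coproduct_monoid : monoid_morphism coproduct.
Proof. exact/uext_monoid/primitive_lie. Qed.
HB.instance Definition _ :=
  GRing.isMonoidMorphism.Build U (tensor U U) coproduct coproduct_monoid.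

Lemma coproduct_inj x :
  coproduct (uinj x) = tens (uinj x) 1 + tens 1 (uinj x).
Proof. exact/uext_inj/primitive_lie. Qed.

Definition counit : U -> K^o := uext (fun _ : L => 0 : K^o).

Lemma counit_linear : linear counit.
Proof. exact/uext_linear/lie_morphism0. Qed.
HB.instance Definition _ := GRing.isLinear.Build K U K^o _ counit counit_linear.

Lemma counit_monoid : monoid_morphism counit.
Proof. exact/uext_monoid/lie_morphism0. Qed.
HB.instance Definition _ :=
  GRing.isMonoidMorphism.Build U K^o counit counit_monoid.

Lemma counit_inj x : counit (uinj x) = 0.
Proof. exact/uext_inj/lie_morphism0. Qed.

End Coproduct.

(* The homogeneous components of a grading of A by the natural numbers: a family
   of subspaces A_k with A_i A_j included in A_(i+j).  Forming the product of
   the A_k does not use that A is their direct sum. *)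
Record gradation (K : fieldType) (A : algType K) := Gradation {
  homog :> nat -> A -> Prop;
  homog0 : forall k, homog k 0;
  homogP : forall k (c : K) x y,
    homog k x -> homog k y -> homog k (c *: x + y);
  homog1 : homog 0%N 1;
  homogM : forall i j x y, homog i x -> homog j y -> homog (i + j)%N (x * y)
}.

(* The completion of a graded algebra: the direct product of its homogeneous
   components, with the Cauchy product. *)
Section Completion.
Variables (K : fieldType) (A : algType K) (G : gradation A).

Record compl := Compl { gcomp : nat -> A; gcompP : forall k, G k (gcomp k) }.

HB.instance Definition _ := gen_eqMixin compl.
HB.instance Definition _ := gen_choiceMixin compl.

Lemma complP (f g : compl) : gcomp f =1 gcomp g -> f = g.
Proof.
case: f g => [f fP] [g gP] /= /funext fg; case: _ / fg in gP *.
by congr Compl; exact: Prop_irrelevance.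
Qed.

Lemma homogD k x y : G k x -> G k y -> G k (x + y).
Proof. by move=> Gx Gy; rewrite -[x]scale1r; exact: homogP. Qed.

Lemma homogZ k (c : K) x : G k x -> G k (c *: x).
Proof. by move=> Gx; rewrite -[_ *: _]addr0; apply: homogP => //; exact: homog0. Qed.

Lemma homogN k x : G k x -> G k (- x).
Proof. by rewrite -scaleN1r; exact: homogZ. Qed.

Lemma homog_sum k (I : Type) (r : seq I) (P : pred I) (F : I -> A) :
  (forall i, P i -> G k (F i)) -> G k (\sum_(i <- r | P i) F i).
Proof.
by move=> GF; apply: (big_ind (G k)) => //; [exact: homog0 | exact: homogD].
Qed.

Lemma cauchyP (f g : compl) k :
  G k (\sum_(i < k.+1) gcomp f i * gcomp g (k - i)%N).
Proof.
apply: homog_sum => i _; rewrite -[k in X in X (_ * _)](@subnKC i) -1?ltnS //.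
by apply: homogM; exact: gcompP.
Qed.

Lemma conePk k : G k ((k == 0%N)%:R).
Proof. by case: eqP => [->|_]; [exact: homog1 | exact: homog0]. Qed.

Definition c0 := Compl (fun k => homog0 G k).
Definition cadd (f g : compl) := Compl (fun k => homogD (gcompP f k) (gcompP g k)).
Definition copp (f : compl) := Compl (fun k => homogN (gcompP f k)).
Definition cscale (c : K) (f : compl) := Compl (fun k => homogZ c (gcompP f k)).
Definition cone := Compl conePk.

Fact cmul_key : unit. Proof. exact: tt. Qed.
Definition cmul : compl -> compl -> compl :=
  locked_with cmul_key (fun f g => Compl (cauchyP f g)).

Lemma caddA : associative cadd.
Proof. by move=> f g h; apply: complP => k; exact: addrA. Qed.
Lemma caddC : commutative cadd.
Proof. by move=> f g; apply: complP => k; exact: addrC. Qed.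
Lemma cadd0 : left_id c0 cadd.
Proof. by move=> f; apply: complP => k; exact: add0r. Qed.
Lemma caddN : left_inverse c0 copp cadd.
Proof. by move=> f; apply: complP => k; exact: addNr. Qed.

HB.instance Definition _ :=
  GRing.isZmodule.Build compl caddA caddC cadd0 caddN.

Lemma cscaleA a b f : cscale a (cscale b f) = cscale (a * b) f.
Proof. by apply: complP => k; exact: scalerA. Qed.
Lemma cscale1 : left_id 1 cscale.
Proof. by move=> f; apply: complP => k; exact: scale1r. Qed.
Lemma cscaleDr : right_distributive cscale +%R.
Proof. by move=> c f g; apply: complP => k; exact: scalerDr. Qed.
Lemma cscaleDl f : {morph cscale^~ f : a b / a + b}.
Proof. by move=> a b; apply: complP => k; exact: scalerDl. Qed.

HB.instance Definition _ := GRing.Zmodule_isLmodule.Build K compl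
  cscaleA cscale1 cscaleDr cscaleDl.

Lemma gcomp_cmul f g k :
  gcomp (cmul f g) k = \sum_(i < k.+1) gcomp f i * gcomp g (k - i)%N.
Proof. by rewrite /cmul locked_withE. Qed.

Let tr n (f : compl) : {poly A} := \poly_(i < n) gcomp f i.

Let coef_tr n f k : (k < n)%N -> (tr n f)`_k = gcomp f k.
Proof. by move=> kn; rewrite coef_poly kn. Qed.

Let cmul_tr n f g k : (k < n)%N -> gcomp (cmul f g) k = (tr n f * tr n g)`_k.
Proof.
move=> kn; rewrite gcomp_cmul coefM; apply: eq_bigr => i _.
rewrite !coef_tr //; first by apply: leq_ltn_trans kn; exact: leq_subr.
by apply: leq_trans kn; exact: ltn_ord.
Qed.

Lemma cmulA : associative cmul.
Proof.
move=> f g h; apply: complP => k; rewrite !gcomp_cmul.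
transitivity ((tr k.+1 f * (tr k.+1 g * tr k.+1 h))`_k).
  rewrite coefM; apply: eq_bigr => i _.
  rewrite (coef_tr _ (ltn_ord i)) -cmul_tr // ltnS; exact: leq_subr.
rewrite mulrA coefM; apply: eq_bigr => i _.
by rewrite -(cmul_tr _ _ (ltn_ord i)) coef_tr // ltnS; exact: leq_subr.
Qed.

Lemma cmul1l : left_id cone cmul.
Proof.
move=> f; apply: complP => k; rewrite gcomp_cmul big_ord_recl /= mul1r subn0.
by rewrite big1 ?addr0 // => i _; rewrite mul0r.
Qed.

Lemma cmul1r : right_id cone cmul.
Proof.
move=> f; apply: complP => k; rewrite gcomp_cmul big_ord_recr /= subnn mulr1.
rewrite big1 ?add0r // => i _.
by rewrite subn_eq0 leqNgt ltn_ord mulr0.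
Qed.

Lemma cmulDl : left_distributive cmul +%R.
Proof.
move=> f g h; apply: complP => k; rewrite [RHS]/= !gcomp_cmul -big_split.
by apply: eq_bigr => i _; exact: mulrDl.
Qed.

Lemma cmulDr : right_distributive cmul +%R.
Proof.
move=> f g h; apply: complP => k; rewrite [RHS]/= !gcomp_cmul -big_split.
by apply: eq_bigr => i _; exact: mulrDr.
Qed.

Lemma cone_neq0 : cone != 0.
Proof.
apply/eqP => /(congr1 (fun f => gcomp f 0%N)) /= e.
by have := oner_neq0 A; rewrite [1]e eqxx.
Qed.

HB.instance Definition _ := GRing.Zmodule_isNzRing.Build compl
  cmulA cmul1l cmul1r cmulDl cmulDr cone_neq0.

Lemma ccscalerAl (c : K) (f g : compl) : c *: (f * g) = (c *: f : compl) * g.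
Proof.
apply: complP => k; rewrite [LHS]/= !gcomp_cmul scaler_sumr.
by apply: eq_bigr => i _; exact: scalerAl.
Qed.
HB.instance Definition _ := GRing.Lmodule_isLalgebra.Build K compl ccscalerAl.

Lemma ccscalerAr (c : K) (f g : compl) : c *: (f * g) = f * (c *: g : compl).
Proof.
apply: complP => k; rewrite [LHS]/= !gcomp_cmul scaler_sumr.
by apply: eq_bigr => i _; exact: scalerAr.
Qed.
HB.instance Definition _ := GRing.Lalgebra_isAlgebra.Build K compl ccscalerAr.

Lemma gcompD (f g : compl) k : gcomp (f + g) k = gcomp f k + gcomp g k.
Proof. by []. Qed.
Lemma gcompZ (c : K) (f : compl) k : gcomp (c *: f) k = c *: gcomp f k.
Proof. by []. Qed.
Lemma gcomp0 k : gcomp 0 k = 0.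
Proof. by []. Qed.
Lemma gcomp1 k : gcomp 1 k = (k == 0%N)%:R.
Proof. by []. Qed.
Lemma gcompM (f g : compl) k :
  gcomp (f * g) k = \sum_(i < k.+1) gcomp f i * gcomp g (k - i)%N.
Proof. exact: gcomp_cmul. Qed.

(* A homogeneous element of A, seen in the completion. *)
Lemma chomogP d x (Gx : G d x) k : G k (if k == d then x else 0).
Proof. by case: eqP => [->|_]; [exact: Gx | exact: homog0]. Qed.

Definition chomog d x (Gx : G d x) : compl := Compl (chomogP Gx).

(* The sum of the power series with coefficients a at an element f whose
   degree-0 component vanishes.  Then f ^+ n has no component of degree
   less than n, so the truncation below drops only zero terms. *)
Lemma cseriesP (a : nat -> K) (f : compl) k :
  G k (\sum_(n < k.+1) a n *: gcomp (f ^+ n) k).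
Proof. by apply: homog_sum => n _; apply: homogZ; exact: gcompP. Qed.

Definition cseries (a : nat -> K) (f : compl) : compl := Compl (cseriesP a f).

Definition cexp (f : compl) : compl := cseries (fun n => (n`!)%:R^-1) f.

(* ln g = sum_(n >= 1) (-1)^(n+1) / n (g - 1)^n, for g with degree-0
   component 1. *)
Definition cln (g : compl) : compl :=
  cseries (fun n => if n == 0%N then 0 else (-1) ^+ n.+1 / n%:R) (g - 1).

End Completion.

Definition degree_preserving (K : fieldType) (A B : algType K)
    (GA : gradation A) (GB : gradation B) (f : A -> B) : Prop :=
  forall k x, GA k x -> GB k (f x).

Definition cmap (K : fieldType) (A B : algType K) (GA : gradation A)
    (GB : gradation B) (f : {linear A -> B}) (fG : degree_preserving GA GB f)
    (u : compl GA) : compl GB :=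
  Compl (fun k => fG k _ (gcompP u k)).

Section TrivialGradation.
Variable K : fieldType.

Definition triv_homog (k : nat) (x : K^o) : Prop := k <> 0%N -> x = 0.

Lemma triv_homogP k (c : K) (x y : K^o) :
  triv_homog k x -> triv_homog k y -> triv_homog k (c *: x + y).
Proof. by move=> x0 y0 k0; rewrite x0 // y0 // scaler0 addr0. Qed.

Lemma triv_homogM i j (x y : K^o) :
  triv_homog i x -> triv_homog j y -> triv_homog (i + j) (x * y).
Proof.
case: i => [|i] hx hy; last by rewrite hx // mul0r.
by move=> j0; rewrite hy // mulr0.
Qed.

Definition triv_gradation : gradation (K^o : algType K) :=
  @Gradation K K^o triv_homog (fun _ _ => erefl) triv_homogP
    (fun h => False_ind _ (h erefl)) triv_homogM.

End TrivialGradation.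

Section TensorGradation.
Variables (K : fieldType) (A B : algType K).
Variables (GA : gradation A) (GB : gradation B).

Inductive tens_homog : nat -> tensor A B -> Prop :=
| tens_homog0 k : tens_homog k 0
| tens_homogP i j (c : K) a b t : GA i a -> GB j b ->
    tens_homog (i + j)%N t -> tens_homog (i + j)%N (c *: tens a b + t).

Lemma tens_homog_lin k (c : K) s t :
  tens_homog k s -> tens_homog k t -> tens_homog k (c *: s + t).
Proof.
move=> hs; elim: hs t => {k s} [k|i j d a b s Ga Gb _ IH] t ht.
  by rewrite scaler0 add0r.
by rewrite scalerDr scalerA -addrA; apply: tens_homogP => //; exact: IH.
Qed.

Lemma tens_homog_tens i j a b : GA i a -> GB j b -> tens_homog (i + j) (tens a b).
Proof.
move=> Ga Gb; rewrite -[tens a b]scale1r -[_ *: _]addr0.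
by apply: tens_homogP => //; exact: tens_homog0.
Qed.

Lemma tens_homog1 : tens_homog 0 1.
Proof. by rewrite -tens1; apply: (@tens_homog_tens 0 0); exact: homog1. Qed.

Lemma tens_homogM i j s t :
  tens_homog i s -> tens_homog j t -> tens_homog (i + j) (s * t).
Proof.
move=> hs ht; elim: hs => {i s} [i|i i' c a b s Ga Gb _ IH].
  by rewrite mul0r; exact: tens_homog0.
rewrite mulrDl -scalerAl; apply: tens_homog_lin => //.
elim: ht {IH} => {j t} [j|j j' d a' b' t Ga' Gb' _ IH].
  by rewrite mulr0; exact: tens_homog0.
rewrite mulrDr -scalerAr tensM; apply: tens_homog_lin => //.
by rewrite addnACA; apply: tens_homog_tens; exact: homogM.
Qed.

Definition tens_gradation : gradation (tensor A B) :=
  Gradation tens_homog0 tens_homog_lin tens_homog1 tens_homogM.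

Lemma ctensP (f : compl GA) (g : compl GB) k :
  tens_homog k (\sum_(i < k.+1) tens (gcomp f i) (gcomp g (k - i)%N)).
Proof.
apply: (@homog_sum _ _ tens_gradation) => i _ /=.
rewrite -[k in tens_homog k](@subnKC i) -1?ltnS //.
by apply: tens_homog_tens; exact: gcompP.
Qed.

(* The tensor f (x) g of two elements of the completions. *)
Definition ctens (f : compl GA) (g : compl GB) : compl tens_gradation :=
  @Compl _ _ tens_gradation _ (ctensP f g).

End TensorGradation.

Section DegreePreserving.
Variable K : fieldType.

Lemma tmap_degree (A A' B B' : algType K) (GA : gradation A)
    (GA' : gradation A') (GB : gradation B) (GB' : gradation B')
    (f : {linear A -> A'}) (g : {linear B -> B'}) :
  degree_preserving GA GA' f -> degree_preserving GB GB' g ->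
  degree_preserving (tens_gradation GA GB) (tens_gradation GA' GB') (tmap f g).
Proof.
move=> fG gG k t; elim=> {k t} [k|i j c a b t Ga Gb _ IH].
  by rewrite linear0; exact: tens_homog0.
rewrite linearP /= tmapE; apply: tens_homogP => //; [exact: fG | exact: gG].
Qed.

Lemma idfun_degree (A : algType K) (GA : gradation A) :
  degree_preserving GA GA (idfun : {linear A -> A}).
Proof. by []. Qed.

Lemma tassoc_degree (A B C : algType K) (GA : gradation A) (GB : gradation B)
    (GC : gradation C) :
  degree_preserving (tens_gradation GA (tens_gradation GB GC))
    (tens_gradation (tens_gradation GA GB) GC) (@tassoc K A B C).
Proof.
move=> k t; elim=> {k t} [k|i j c a s t Ga Gs _ IH].
  by rewrite linear0; exact: tens_homog0.
rewrite linearP /=; apply: (homogP (g := tens_gradation _ _)) => //.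
elim: Gs {IH} => {j s} [j|j l d b e s Gb Ge _ IH].
  rewrite (linear_zero (tens_linearr a)) linear0; exact: tens_homog0.
rewrite tens_linearr linearP /= tassocE.
apply: (homogP (g := tens_gradation _ _)) => //.
by rewrite addnA; apply: tens_homog_tens => //; exact: tens_homog_tens.
Qed.

Lemma tunitl_degree (A : algType K) (GA : gradation A) :
  degree_preserving (tens_gradation (triv_gradation K) GA) GA (@tunitl K A).
Proof.
move=> k t; elim=> {k t} [k|i j c a b t Ga Gb _ IH].
  by rewrite linear0; exact: homog0.
rewrite linearP /= tunitlE; apply: homogP => //.
case: i Ga {IH} => [_|i Ga]; first exact: homogZ.
by rewrite Ga // scale0r; exact: homog0.
Qed.

Lemma tunitr_degree (A : algType K) (GA : gradation A) :
  degree_preserving (tens_gradation GA (triv_gradation K)) GA (@tunitr K A).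
Proof.
move=> k t; elim=> {k t} [k|i j c a b t Ga Gb _ IH].
  by rewrite linear0; exact: homog0.
rewrite linearP /= tunitrE; apply: homogP => //.
case: j Gb {IH} => [_|j Gb]; first by rewrite addn0; exact: homogZ.
by rewrite Gb // scale0r; exact: homog0.
Qed.

End DegreePreserving.

(* The grading of U(L) induced by homogeneous components L_k of L: the degree-k
   component is spanned by the products of homogeneous elements of L of total
   degree k. *)
Section EnvelopingGradation.
Variables (K : fieldType) (L : lieType K) (LG : nat -> L -> Prop).
Local Notation U := (Uenv L).

Inductive uenv_homog : nat -> U -> Prop :=
| uenv_homog0 k : uenv_homog k 0
| uenv_homogP k (c : K) u v :
    uenv_homog k u -> uenv_homog k v -> uenv_homog k (c *: u + v)
| uenv_homog1 : uenv_homog 0%N 1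
| uenv_homog_inj k x : LG k x -> uenv_homog k (uinj x)
| uenv_homogM i j u v :
    uenv_homog i u -> uenv_homog j v -> uenv_homog (i + j)%N (u * v).

Definition uenv_gradation : gradation U :=
  Gradation uenv_homog0 uenv_homogP uenv_homog1 uenv_homogM.

Local Notation G1 := uenv_gradation.
Local Notation G2 := (tens_gradation G1 G1).
Local Notation G3 := (tens_gradation G2 G1).

Lemma coproduct_degree : degree_preserving G1 G2 (@coproduct K L).
Proof.
move=> k u; elim=> {k u} [k|k c u v _ IHu _ IHv||k x Lx|i j u v _ IHu _ IHv].
- by rewrite linear0; exact: tens_homog0.
- by rewrite linearP; exact: (homogP (g := G2)).
- by rewrite rmorph1; exact: (homog1 G2).
- rewrite coproduct_inj; apply: (@homogD _ _ G2).
    rewrite -[k]addn0; apply: tens_homog_tens; last exact: (homog1 G1).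
    exact: uenv_homog_inj.
  rewrite -[k]add0n; apply: tens_homog_tens; first exact: (homog1 G1).
  exact: uenv_homog_inj.
- by rewrite rmorphM; exact: (homogM (g := G2)).
Qed.

Lemma counit_degree :
  degree_preserving G1 (triv_gradation K) (@counit K L).
Proof.
move=> k u; elim=> {k u} [k|k c u v _ IHu _ IHv||k x Lx|i j u v _ IHu _ IHv].
- by rewrite linear0.
- by rewrite linearP; exact: (homogP (g := triv_gradation K)).
- by rewrite rmorph1; exact: (homog1 (triv_gradation K)).
- by rewrite counit_inj.
- by rewrite rmorphM; exact: (homogM (g := triv_gradation K)).
Qed.

Let id_degree := idfun_degree (GA := G1).

(* The third tensor power is (U (x) U) (x) U. *)
Definition cassoc : compl (tens_gradation G1 G2) -> compl G3 :=
  cmap (@tassoc_degree K U U U G1 G1 G1).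

Definition coproduct_id : compl G2 -> compl G3 :=
  cmap (tmap_degree coproduct_degree id_degree).

Definition id_coproduct (F : compl G2) : compl G3 :=
  cassoc (cmap (tmap_degree id_degree coproduct_degree) F).

Definition counit_id (F : compl G2) : compl G1 :=
  cmap (@tunitl_degree K U G1) (cmap (tmap_degree counit_degree id_degree) F).

Definition id_counit (F : compl G2) : compl G1 :=
  cmap (@tunitr_degree K U G1) (cmap (tmap_degree id_degree counit_degree) F).

Definition is_twist (F : compl G2) : Prop :=
  [/\ exists F' : compl G2, F * F' = 1 /\ F' * F = 1,
      (ctens F 1 : compl G3) * coproduct_id F =
        cassoc (ctens 1 F) * id_coproduct F,
      counit_id F = 1 & id_counit F = 1].

End EnvelopingGradation.

(* The grading deg H = 0, deg A = deg B = 1, deg E = 2. *)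
Section Grading.
Variables (K : fieldType) (L : finLieType K) (H A B E : L).

Definition Lhomog (d : nat) : {vspace L} :=
  match d with
  | 0 => <[H]>
  | 1 => <[A]> + <[B]>
  | 2 => <[E]>
  | _ => 0
  end%VS.

Definition gradU : gradation (Uenv L) :=
  uenv_gradation (fun d x => x \in Lhomog d).

Lemma gradU_H : gradU 0%N (uinj H).
Proof. by apply: uenv_homog_inj; exact: memv_line. Qed.

Lemma gradU_A : gradU 1%N (uinj A).
Proof.
apply: uenv_homog_inj.
by have := memv_add (memv_line A) (mem0v <[B]>%VS); rewrite addr0.
Qed.

Lemma gradU_B : gradU 1%N (uinj B).
Proof.
apply: uenv_homog_inj.
by have := memv_add (mem0v <[A]>%VS) (memv_line B); rewrite add0r.
Qed.

Lemma gradU_E : gradU 2%N (uinj E).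
Proof. by apply: uenv_homog_inj; exact: memv_line. Qed.

Definition cH : compl gradU := chomog gradU_H.
Definition cA : compl gradU := chomog gradU_A.
Definition cB : compl gradU := chomog gradU_B.
Definition cE : compl gradU := chomog gradU_E.

End Grading.

(* Main.v *)
(** Write [sigma_a], [A_a], ... for the copies in the [a]-th tensor leg, [x = 1 + gamma E],
    [J = exp(H (x) sigma)] and [X = exp(A (x) B x^-1)].  Since [J_23 E_2 = E_2 x_3 J_23],
    conjugation by [J_23] maps [Delta(x)_23] to [x_2 x_3], hence [Delta(sigma)_23] to
    [sigma_2 + sigma_3]; this turns [J_23 (id (x) Delta)(J)] into [J_12 J_13 J_23].
    As [A] and [B] have weights adding up to that of [E], conjugation by [J_13 J_23] maps
    [A_1 B_2 Delta(x)^-1] to [A_1 B_2 x_2^-1].  Finally conjugation by [X_23] adds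
    [gamma E_2 B_3 x_3^-1] to [B_2], and
    [(B_2 + B_3 + gamma E_2 B_3 x_3^-1) Delta(x)^-1 = B_2 Delta(x)^-1 + B_3 x_3^-1],
    so both sides are [J_12 J_13 J_23 exp(A_1 B_2 Delta(x)^-1) X_13 X_23]. *)

Require Import Defs.
From HB Require Import structures.
From mathcomp Require Import all_boot all_algebra.
From mathcomp Require Import reals complex.
Import GRing.Theory.
Local Open Scope ring_scope.

Set Implicit Arguments.
Unset Strict Implicit.
Unset Printing Implicit Defensive.

(** * Power series in a completed graded algebra *)

Section CompletedSeries.
Variables (K : fieldType) (A : algType K) (G : gradation A).
Local Notation C := (compl G).
Implicit Types (f g h u v w : C) (a : nat -> K).

Lemma gcomp_sum (I : Type) (r : seq I) (P : pred I) (F : I -> C) k :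
  gcomp (\sum_(i <- r | P i) F i) k = \sum_(i <- r | P i) gcomp (F i) k.
Proof. exact: (big_morph (fun f => gcomp f k) (fun f g => gcompD f g k) (gcomp0 G k)). Qed.

(** Congruence modulo degrees at least [n]. Identities between infinite series are proved modulo
    every [n], where each series may be replaced by a finite sum. *)
Definition agree n f g := forall i, (i < n)%N -> gcomp f i = gcomp g i.

Lemma agree_eq f g : (forall n, agree n f g) -> f = g.
Proof. by move=> e; apply: complP => k; apply: (e k.+1). Qed.

Lemma agree_sym n f g : agree n f g -> agree n g f.
Proof. by move=> e i lt_in; rewrite e. Qed.

Lemma agree_trans n g f h : agree n f g -> agree n g h -> agree n f h.
Proof. by move=> e1 e2 i lt_in; rewrite e1 ?e2. Qed.

Lemma agreeD n f f' g g' : agree n f f' -> agree n g g' -> agree n (f + g) (f' + g').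
Proof. by move=> e1 e2 i lt_in; rewrite !gcompD e1 ?e2. Qed.

Lemma agreeM n f f' g g' : agree n f f' -> agree n g g' -> agree n (f * g) (f' * g').
Proof.
move=> e1 e2 k lt_kn; rewrite !gcompM; apply: eq_bigr => i _.
rewrite e1 ?e2 //; first exact: leq_ltn_trans (leq_subr _ _) lt_kn.
by apply: leq_trans lt_kn; exact: ltn_ord.
Qed.

Lemma gcompM0 f g : gcomp (f * g) 0 = gcomp f 0 * gcomp g 0.
Proof. by rewrite gcompM big_ord1 subnn. Qed.

(** Each factor without constant component raises the lowest occurring degree by at least one. *)
Lemma gcompX_lt f n k : gcomp f 0 = 0 -> (k < n)%N -> gcomp (f ^+ n) k = 0.
Proof.
move=> f0; elim: n k => // n IH k lt_kn; rewrite exprS gcompM big1 // => -[i /= ik] _.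
case: i ik => [|i] ik; first by rewrite f0 mul0r.
by rewrite IH ?mulr0 //; case: k lt_kn ik => // k; rewrite subSS => ? _; apply: leq_ltn_trans (leq_subr _ _) _.
Qed.

Lemma gcompM0_r f g : gcomp g 0 = 0 -> gcomp (f * g) 0 = 0.
Proof. by move=> g0; rewrite gcompM0 g0 mulr0. Qed.

Definition ctrunc N a f : C := \sum_(n < N) a n *: f ^+ n.

(** In degree [k] the definition of [cseries] already stops at the power [k]; the further powers
    below [N] have no component in that degree. *)
Lemma cseries_agree N a f : gcomp f 0 = 0 -> agree N (cseries a f) (ctrunc N a f).
Proof.
move=> f0 k lt_kN; rewrite gcomp_sum.
have -> : gcomp (cseries a f) k = \sum_(n < k.+1) gcomp (a n *: f ^+ n) k by [].
rewrite -!(big_mkord xpredT (fun n => gcomp (a n *: f ^+ n) k)).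
rewrite (@big_cat_nat _ _ _ k.+1 0 N) //= [X in _ = _ + X]big_nat_cond.
rewrite [X in _ = _ + X]big1 ?addr0 // => n /andP[/andP[lt_kn _] _].
by rewrite gcompX_lt ?scaler0.
Qed.

Lemma gcomp_cseries0 a f : a 0 = 0 -> gcomp (cseries a f) 0 = 0.
Proof. by move=> a0; rewrite /= big_ord1 a0 scale0r. Qed.

(** The relation passes to all powers by induction, hence to every truncation. Writing a conjugation
    as [w * f = g * w] avoids inverses; the later conjugations of exponentials and logarithms take
    this form. *)
Lemma cseries_intertwine a w f g : gcomp f 0 = 0 -> gcomp g 0 = 0 ->
  w * f = g * w -> w * cseries a f = cseries a g * w.
Proof.
move=> f0 g0 e; apply: agree_eq => n.
apply: agree_trans (agreeM (fun _ _ => erefl) (cseries_agree a f0)) _.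
apply/agree_sym/(agree_trans (agreeM (cseries_agree a g0) (fun _ _ => erefl))).
rewrite mulr_sumr mulr_suml => k _; congr (gcomp _ k); apply: eq_bigr => -[i _] _ /=.
rewrite -scalerAl -scalerAr; congr (_ *: _).
by elim: i => [|i IH]; rewrite ?mul1r ?mulr1 // exprSr -mulrA -e mulrA IH -mulrA -exprSr.
Qed.

Lemma comm_cseries a w f : gcomp f 0 = 0 -> GRing.comm w f -> GRing.comm w (cseries a f).
Proof. by move=> f0 e; apply: cseries_intertwine. Qed.

Lemma cln1D u : cln (1 + u) = cseries (fun n => if n == 0%N then 0 else (-1) ^+ n.+1 / n%:R) u.
Proof. by rewrite /cln addrAC subrr add0r. Qed.

Lemma comm_cln w u : gcomp u 0 = 0 -> GRing.comm w u -> GRing.comm w (cln (1 + u)).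
Proof. by move=> u0 e; rewrite cln1D; exact: comm_cseries. Qed.

Lemma cln_intertwine w u v : gcomp u 0 = 0 -> gcomp v 0 = 0 ->
  w * (1 + u) = (1 + v) * w -> w * cln (1 + u) = cln (1 + v) * w.
Proof.
move=> u0 v0; rewrite mulrDr mulrDl mulr1 mul1r => /addrI e.
by rewrite !cln1D; exact: cseries_intertwine.
Qed.

Lemma comm_cexp w f : gcomp f 0 = 0 -> GRing.comm w f -> GRing.comm w (cexp f).
Proof. exact: comm_cseries. Qed.

Lemma cexp0 : cexp (0 : C) = 1.
Proof.
apply: complP => k; rewrite /= big_ord_recl /= fact0 invr1 scale1r.
by rewrite big1 ?addr0 // => i _; rewrite expr0n /= scaler0.
Qed.

Lemma gcomp_cexp0 f : gcomp (cexp f) 0 = 1.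
Proof. by rewrite /= big_ord1 fact0 invr1 scale1r. Qed.

Lemma gcomp_cln0 f : gcomp (cln f) 0 = 0.
Proof. exact: gcomp_cseries0. Qed.

Lemma cln1 : cln (1 : C) = 0.
Proof.
apply: complP => k; rewrite /= subrr big1 // => -[[|i] ?] _ /=; first by rewrite scale0r.
by rewrite expr0n /= scaler0.
Qed.

(* The derivation multiplying the component of degree k by k; in characteristic 0
   it plays the role of d/dt in the arguments on exp and ln. *)
Definition cder f : C := Compl (fun k => homogZ k%:R (gcompP f k)).

Lemma gcomp_cder f k : gcomp (cder f) k = k%:R *: gcomp f k.
Proof. by []. Qed.

Lemma cderD f g : cder (f + g) = cder f + cder g.
Proof. by apply: complP => k; rewrite [LHS]scalerDr. Qed.

Lemma cderZ (c : K) f : cder (c *: f) = c *: cder f.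
Proof. by apply: complP => k; rewrite !(gcomp_cder, gcompZ) !scalerA mulrC. Qed.

Lemma cder1 : cder 1 = 0.
Proof.
by apply: complP => k; rewrite gcomp_cder gcomp1; case: k => [|k]; rewrite ?scale0r ?scaler0.
Qed.

Lemma cderM f g : cder (f * g) = cder f * g + f * cder g.
Proof.
apply: complP => k; rewrite gcompD !gcompM gcomp_cder gcompM scaler_sumr -big_split.
apply: eq_bigr => i _ /=; rewrite -scalerAl -scalerAr -scalerDl -natrD subnKC //.
by rewrite -ltnS.
Qed.

Lemma cder_sum n (F : 'I_n -> C) : cder (\sum_i F i) = \sum_i cder (F i).
Proof.
apply: (big_morph _ cderD); apply: complP => k.
by rewrite gcomp_cder gcomp0 scaler0.
Qed.

Lemma cderX f n : GRing.comm f (cder f) -> cder (f ^+ n.+1) = n.+1%:R *: (cder f * f ^+ n).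
Proof.
move=> cf; elim: n => [|n IH]; first by rewrite expr0 mulr1 scale1r.
rewrite exprS cderM IH -scalerAr mulrA cf -mulrA -exprS -[X in X + _]scale1r -scalerDl.
by rewrite nat1r.
Qed.

Lemma agree_cder n f g : agree n f g -> agree n (cder f) (cder g).
Proof. by move=> e k kn; rewrite !gcomp_cder e. Qed.

(** Termwise differentiation; that [f] commutes with its derivative gives the power rule its usual
    shape. *)
Lemma cder_cseries a f : gcomp f 0 = 0 -> GRing.comm f (cder f) ->
  cder (cseries a f) = cder f * cseries (fun n => n.+1%:R * a n.+1) f.
Proof.
move=> f0 cf; apply: agree_eq => N.
(* One extra term is kept: the constant term is killed by [cder], which leaves [N] terms with the
   index shifted by one. *)
apply: (@agree_trans _ (cder (ctrunc N.+1 a f))).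
  by move=> k kN; apply: agree_cder (@cseries_agree N.+1 a f f0) _ _; exact: ltnW.
apply/agree_sym/(agree_trans (agreeM (fun _ _ => erefl) (cseries_agree _ f0))).
rewrite /ctrunc cder_sum big_ord_recl expr0 cderZ cder1 scaler0 add0r mulr_sumr.
move=> k _; congr (gcomp _ k); apply: eq_bigr => i _ /=.
by rewrite cderZ cderX // -scalerAr !scalerA mulrC.
Qed.

(** * Exponential, logarithm and geometric series in characteristic 0 *)

Hypothesis K0 : [pchar K] =i pred0.

Let natrS_neq0 n : (n.+1%:R : K) != 0.
Proof. by have /pcharf0P -> := K0. Qed.

(** In positive degrees [cder] multiplies by an invertible scalar. This is the uniqueness principle
    that replaces solving a differential equation with an initial value. *)
Lemma cder_inj f g : gcomp f 0 = gcomp g 0 -> cder f = cder g -> f = g.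
Proof.
move=> e0 e; apply: complP => -[|k] //.
have /(congr1 (fun h => k.+1%:R^-1 *: gcomp h k.+1)) := e.
by rewrite !gcomp_cder !scalerA mulVf ?scale1r //.
Qed.

Lemma cexpD f g : gcomp f 0 = 0 -> gcomp g 0 = 0 -> GRing.comm f g ->
  cexp (f + g) = cexp f * cexp g.
Proof.
move=> f0 g0 cfg; apply: agree_eq => N.
pose e n : K := (n`!)%:R^-1.
have fg0 : gcomp (f + g) 0 = 0 by rewrite gcompD f0 g0 addr0.
apply: agree_trans (cseries_agree e fg0) _.
apply/agree_sym/(agree_trans (agreeM (cseries_agree e f0) (cseries_agree e g0))).
pose P (u : C) : {poly C} := \poly_(i < N) (e i *: u ^+ i).
(* The product of the truncated series is read off the product of polynomials with
   coefficients in C at 1, whose n-th coefficient is (f + g)^n / n! for n < N. *)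
have Pt u : ctrunc N e u = (P u).[1].
  by rewrite horner_poly; apply: eq_bigr => i _; rewrite expr1n mulr1.
rewrite (Pt f) (Pt g) -hornerM_comm; last by rewrite /comm_poly mulr1 mul1r.
have sz : (size (P f * P g)%R <= N + N)%N.
  apply: leq_trans (size_polyMleq _ _) _.
  by apply: leq_trans (leq_pred _) _; apply: leq_add; exact: size_poly.
rewrite (horner_coef_wide 1 sz) big_split_ord /=.
rewrite -[X in agree _ _ X]addr0; apply: agreeD.
  rewrite /ctrunc => k _; congr (gcomp _ k); apply: eq_bigr => -[n nN] _ /=.
  rewrite expr1n mulr1 addrC exprDn_comm; last exact: commr_sym.
  rewrite coefM scaler_sumr; apply: eq_bigr => -[i /= iN] _.
  rewrite !coef_poly (leq_trans iN nN) (leq_ltn_trans (leq_subr _ _) nN).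
  rewrite -scalerAl -scalerAr scalerA.
  rewrite (commrX _ (commr_sym (commrX _ cfg))) -scaler_nat scalerA; congr (_ *: _).
  rewrite /e -(bin_fact (n := n) (m := i)) // !natrM !invfM mulrAC mulVf ?mul1r //.
  (* Written as a successor, the binomial coefficient is nonzero in [K] by [natrS_neq0]. *)
  by rewrite -(prednK (_ : (0 < 'C(n, i))%N)) ?bin_gt0.
(* The coefficients of index [N + i] are combinations of products of [N + i] factors [f] or [g], so
   they have no component of degree below [N]. *)
move=> k kN; rewrite gcomp_sum gcomp0 big1 // => i _.
rewrite expr1n mulr1 coefM gcomp_sum big1 // => -[j /= jN] _.
rewrite !coef_poly; case: ifP => _; last by rewrite mul0r.
case: ifP => _; last by rewrite mulr0.
rewrite -scalerAl -scalerAr !gcompZ gcompM big1 ?scaler0 // => -[l /= lk] _.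
case: (ltnP l j) => [lj|jl]; first by rewrite gcompX_lt ?mul0r.
rewrite [X in _ * X]gcompX_lt ?mulr0 //.
apply: leq_ltn_trans (leq_sub2l _ jl) _; apply: ltn_sub2r; last first.
  by apply: leq_trans kN (leq_addr _ _).
by apply: leq_ltn_trans jl _; apply: leq_trans lk _; apply: leq_trans kN (leq_addr _ _).
Qed.

(** Moving [b] to the left replaces [f] by [f + s], and the exponential of this sum splits because
    [f] and [s] commute. With [f] built from [H], this rescales weight vectors. *)
Lemma cexp_eigen f b s : gcomp f 0 = 0 -> gcomp s 0 = 0 -> GRing.comm f s ->
  f * b = b * (f + s) -> cexp f * b = b * (cexp f * cexp s).
Proof.
move=> f0 s0 cfs e; rewrite -cexpD //; apply/esym/cseries_intertwine => //.
by rewrite gcompD f0 s0 addr0.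
Qed.

(** The commutator [c] of [f] and [b] commutes with [f], so the expansion of exp(f) b exp(-f) in
    iterated commutators stops after the first one. *)
Lemma cexp_shift f b c : gcomp f 0 = 0 -> GRing.comm c f ->
  f * b = b * f + c -> cexp f * b = (b + c) * cexp f.
Proof.
move=> f0 cfc e; have fX n : f ^+ n.+1 * b = b * f ^+ n.+1 + n.+1%:R *: (c * f ^+ n).
  elim: n => [|n IH]; first by rewrite expr0 mulr1 scale1r.
  rewrite exprS -mulrA IH mulrDr mulrA e mulrDl -mulrA -exprS -addrA; congr (_ + _).
  by rewrite -scalerAr (mulrA f) -cfc -mulrA -exprS -[X in X + _]scale1r -scalerDl nat1r.
pose a n : K := (n`!)%:R^-1; apply: agree_eq => N.
(* The series multiplying [c] is cut one term earlier than the one multiplying [b], because [fX]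
   lowers the exponent next to [c] by one. *)
have S k : agree N (cexp f) (ctrunc (N + k) a f).
  by move=> i iN; apply: (cseries_agree a f0); exact: leq_trans iN (leq_addr _ _).
apply: agree_trans (agreeM (S 1%N) (fun _ _ => erefl)) _; rewrite mulrDl.
apply/agree_sym/(agree_trans (agreeD (agreeM _ (S 1%N)) (agreeM _ (S 0%N)))) => //.
rewrite addn0 addn1 /ctrunc !big_ord_recl mulrDl mulrDr !expr0 -!scalerAl -!scalerAr.
rewrite mul1r mulr1 -addrA => k _; congr (gcomp (_ + _) k).
rewrite mulr_suml !mulr_sumr -big_split; apply: eq_bigr => i _ /=.
rewrite -!scalerAl -!scalerAr fX scalerDr scalerA; congr (_ + _ *: _).
by rewrite /a factS natrM invfM mulrAC mulVf ?mul1r.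
Qed.

Lemma cexpNr f : gcomp f 0 = 0 -> cexp f * cexp (- f) = 1.
Proof.
move=> f0; rewrite -cexpD ?subrr ?cexp0 //; last exact: commrN.
by rewrite -scaleN1r gcompZ f0 scaler0.
Qed.

Lemma cder_cexp f : gcomp f 0 = 0 -> GRing.comm f (cder f) ->
  cder (cexp f) = cder f * cexp f.
Proof.
move=> f0 cf; rewrite cder_cseries //; congr (_ * _); apply: complP => k /=.
apply: eq_bigr => i _; congr (_ *: _).
rewrite factS natrM invfM mulrA divff ?mul1r //.
Qed.

(** The finite sums telescope and leave the remainder [(- u) ^+ N], which lives in degrees at least
    [N]. The series serves below as an explicit inverse of [1 + u]. *)
Lemma geometric_cseries u : gcomp u 0 = 0 -> (1 + u) * cseries (fun n => (-1) ^+ n) u = 1.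
Proof.
move=> u0; apply: agree_eq => N.
apply: agree_trans (agreeM (fun _ _ => erefl) (cseries_agree _ u0)) _.
have -> : ctrunc N (fun n => (-1) ^+ n) u = \sum_(i < N) (- u) ^+ i.
  by apply: eq_bigr => i _; rewrite -[- u]scaleN1r exprZn.
have -> : (1 + u) * \sum_(i < N) (- u) ^+ i = 1 - (- u) ^+ N.
  by rewrite -[RHS]opprB subrX1 -mulNr opprB opprK.
move=> k kN; rewrite -scaleN1r gcompD gcompZ gcompX_lt ?scaler0 ?addr0 //.
by rewrite -scaleN1r gcompZ u0 scaler0.
Qed.

(** The termwise derivative of the logarithm series is the geometric series times [cder u];
    multiplying by [1 + u] clears it. *)
Lemma cder_cln u : gcomp u 0 = 0 -> GRing.comm u (cder u) ->
  (1 + u) * cder (cln (1 + u)) = cder u.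
Proof.
move=> u0 cu; rewrite cln1D cder_cseries //.
have c1 : GRing.comm (1 + u) (cder u) by apply/commr_sym/commrD; [exact: commr1 | exact: commr_sym].
rewrite mulrA c1 -mulrA -[RHS]mulr1 -[X in _ = _ * X](geometric_cseries u0); congr (_ * (_ * _)).
apply: complP => k /=; apply: eq_bigr => i _; congr (_ *: _).
by rewrite mulrCA divff ?mulr1 // !exprS !mulN1r opprK.
Qed.

Lemma invr_geometric u : gcomp u 0 = 0 -> cseries (fun n => (-1) ^+ n) u * (1 + u) = 1.
Proof.
move=> u0; rewrite -[RHS](geometric_cseries u0); apply/esym; apply: comm_cseries => //.
by apply/commr_sym/commrD; [exact: commr1 | ].
Qed.

Lemma cexp_cln u : gcomp u 0 = 0 -> GRing.comm u (cder u) -> cexp (cln (1 + u)) = 1 + u.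
Proof.
move=> u0 cu; set f := cln _; pose g := cseries (fun n => (-1) ^+ n) u.
have f0 : gcomp f 0 = 0 by exact: gcomp_cln0.
have gl : g * (1 + u) = 1 by exact: invr_geometric.
have gr : (1 + u) * g = 1 by exact: geometric_cseries.
have df : (1 + u) * cder f = cder u by exact: cder_cln.
have df' : cder f = g * cder u by rewrite -df mulrA gl mul1r.
have cfu : GRing.comm f u by apply/commr_sym/comm_cln.
have cug : GRing.comm u g by exact: comm_cseries.
have cfg : GRing.comm f g by exact: comm_cseries.
have cfdu : GRing.comm f (cder u) by apply/commr_sym/comm_cln => //; exact: commr_sym.
have cgdu : GRing.comm g (cder u) by apply/commr_sym/comm_cseries => //; exact: commr_sym.
have cfdf : GRing.comm f (cder f) by rewrite df'; exact: commrM.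
suff e : g * cexp f = 1 by rewrite -[LHS]mul1r -[X in X * _]gr -mulrA e mulr1.
have dg : cder g = - (g * cder u * g).
  have := congr1 cder gl; rewrite cderM cderD !cder1 add0r => /eqP.
  rewrite addr_eq0 => /eqP /(congr1 (fun h => h * g)).
  by rewrite -mulrA gr mulr1 mulNr.
(* (1 + u)^-1 exp(ln(1 + u)) is killed by the derivation. *)
apply: cder_inj; first by rewrite gcompM0 gcomp_cexp0 gcomp1 /= big_ord1 expr0 scale1r mulr1.
rewrite cderM cder1 cder_cexp // dg df' -(mulrA g) -cgdu mulNr -!mulrA addNr //.
Qed.

Lemma mul1D1D u v : (1 + u) * (1 + v) = 1 + (u + v + u * v).
Proof. by rewrite mulrDl mul1r mulrDr mulr1 -!addrA (addrCA v). Qed.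

(** Multiplied by [1 + w], the derivatives of both sides reduce to the product rule for
    [(1 + u) * (1 + v)]; both sides vanish in degree 0, so [cder_inj] concludes. *)
Lemma cln_mul1D1D u v : gcomp u 0 = 0 -> gcomp v 0 = 0 ->
    GRing.comm u (cder u) -> GRing.comm v (cder v) -> GRing.comm u v ->
    GRing.comm u (cder v) -> GRing.comm v (cder u) ->
  cln (1 + (u + v + u * v)) = cln (1 + u) + cln (1 + v).
Proof.
move=> u0 v0 cu cv cuv cudv cvdu; set w := _ + u * v.
have ew : (1 + u) * (1 + v) = 1 + w by exact: mul1D1D.
have w0 : gcomp w 0 = 0 by rewrite !gcompD gcompM0 u0 v0 mulr0 !addr0.
have inj1D t (x y : C) : gcomp t 0 = 0 -> (1 + t) * x = (1 + t) * y -> x = y.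
  move=> t0 /(congr1 (fun z => cseries (fun n => (-1) ^+ n) t * z)).
  by rewrite !mulrA invr_geometric // !mul1r.
apply: cder_inj; first by rewrite gcompD !gcomp_cln0 addr0.
apply: (inj1D w) => //.
have dw : cder w = cder u * (1 + v) + (1 + u) * cder v.
  by rewrite /w !cderD cderM mulrDr mulrDl mulr1 mul1r addrACA.
have comm1D (t x : C) : GRing.comm t x -> GRing.comm t (1 + x).
  by move=> ?; apply: commrD => //; exact: commr1.
have cw : GRing.comm w (cder w).
  apply/commr_sym; rewrite /w; apply: commrD; [apply: commrD | apply: commrM];
  apply/commr_sym; rewrite dw; apply: commrD; apply: commrM => //;
  by apply: comm1D => //; exact: commr_sym.
(* The two copies of [1 + w] are factored in opposite orders, so that each logarithmic derivative
   stands next to the factor that clears it. *)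
rewrite [LHS]cder_cln // cderD mulrDr {1}(_ : 1 + w = (1 + v) * (1 + u)); last first.
  by rewrite -ew; apply: comm1D (commr_sym (comm1D _ _ (commr_sym cuv))).
rewrite -{1}ew -!mulrA !cder_cln // dw; congr (_ + _).
exact: comm1D (commr_sym cvdu).
Qed.
End CompletedSeries.

(** * Homogeneous elements of the completion *)

Section HomogeneousElements.
Variables (K : fieldType) (A : algType K) (G : gradation A).

Lemma gcomp_chomog d x (Gx : G d x) k : gcomp (chomog Gx) k = if k == d then x else 0.
Proof. by []. Qed.

Lemma cder_chomog d x (Gx : G d x) : cder (chomog Gx) = d%:R *: chomog Gx.
Proof.
apply: complP => k; rewrite gcomp_cder gcompZ gcomp_chomog.
by case: eqP => [->|_] //; rewrite !scaler0.
Qed.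

Lemma gcomp_chomogM d e x y (Gx : G d x) (Gy : G e y) k :
  gcomp (chomog Gx * chomog Gy) k = if k == (d + e)%N then x * y else 0.
Proof.
rewrite gcompM; case: (leqP d k) => [dk|kd].
  have dk1 : (d < k.+1)%N by [].
  rewrite (bigD1 (Ordinal dk1)) //= eqxx big1 ?addr0.
    rewrite -(eqn_add2l d) subnKC //.
    by case: eqP => _; rewrite ?mulr0.
  by move=> i /eqP ne; case: eqP => [id|_]; [case: ne; exact: val_inj | rewrite mul0r].
rewrite big1 => [|[i ik] _ /=].
  by case: eqP => // kde; move: kd; rewrite kde ltnNge leq_addr.
by case: eqP => [id|_]; [move: ik; rewrite ltnS id leqNgt kd | rewrite mul0r].
Qed.

(** Homogeneity of the bracket, [d + e = f], places all three terms in the same component, where the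
    relation is the given one. *)
Lemma chomog_bracket d e f x y z (Gx : G d x) (Gy : G e y) (Gz : G f z) (c : K) :
    (d + e)%N = f -> x * y - y * x = c *: z ->
  chomog Gx * chomog Gy = chomog Gy * chomog Gx + c *: chomog Gz.
Proof.
move=> de xy; subst f; apply: complP => k; rewrite gcompD gcompZ !gcomp_chomogM gcomp_chomog (addnC e).
by case: eqP => _; rewrite ?scaler0 ?addr0 // -xy addrCA subrr addr0.
Qed.

Lemma chomog_comm d e x y (Gx : G d x) (Gy : G e y) :
  x * y - y * x = 0 -> GRing.comm (chomog Gx) (chomog Gy).
Proof.
move/eqP; rewrite subr_eq0 => /eqP xy; apply: complP => k.
by rewrite !gcomp_chomogM xy addnC.
Qed.

End HomogeneousElements.

(** * Continuous algebra morphisms *)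

Section CompletedMorphism.
Variables (K : fieldType) (A B : algType K) (GA : gradation A) (GB : gradation B).

(** Acting on each component through one algebra morphism makes [phi] compatible with infinite
    series and with [cder]. The existential form is stable under composition. *)
Definition cmorph (phi : compl GA -> compl GB) := exists f : A -> B,
  [/\ linear f, monoid_morphism f & forall u k, gcomp (phi u) k = f (gcomp u k)].

Lemma cmorph_cmap (f : {linear A -> B}) (fG : degree_preserving GA GB f) :
  monoid_morphism f -> cmorph (cmap fG).
Proof. by move=> fM; exists f; split=> //; exact: linearP. Qed.

Variables (phi : compl GA -> compl GB) (phiP : cmorph phi).

Lemma cmorphP (c : K) u v : phi (c *: u + v) = c *: phi u + phi v.
Proof.
by case: phiP => f [fl fM fE]; apply: complP => k; rewrite !(fE, gcompD, gcompZ) fl.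
Qed.

Lemma cmorphD u v : phi (u + v) = phi u + phi v.
Proof. by rewrite -[u]scale1r cmorphP !scale1r. Qed.

Lemma cmorph0 : phi 0 = 0.
Proof. by apply/(addrI (phi 0)); rewrite -cmorphD !addr0. Qed.

Lemma cmorphZ (c : K) u : phi (c *: u) = c *: phi u.
Proof. by rewrite -[c *: u]addr0 cmorphP cmorph0 addr0. Qed.

Lemma cmorph1 : phi 1 = 1.
Proof.
case: phiP => f [fl fM fE]; apply: complP => k; rewrite fE !gcomp1.
by case: k => [|k] /=; [exact: fM.1 | exact: linear_zero].
Qed.

Lemma cmorphM u v : phi (u * v) = phi u * phi v.
Proof.
case: phiP => f [fl fM fE]; apply: complP => k; rewrite fE !gcompM.
have fD x y : f (x + y) = f x + f y by rewrite -[x]scale1r fl !scale1r.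
rewrite (big_morph _ fD (linear_zero fl)); apply: eq_bigr => i _.
by rewrite fM.2 !fE.
Qed.

Lemma cmorphX u n : phi (u ^+ n) = phi u ^+ n.
Proof. by elim: n => [|n IH]; rewrite ?cmorph1 // !exprS cmorphM IH. Qed.

Lemma cmorph_comm u v : GRing.comm u v -> GRing.comm (phi u) (phi v).
Proof. by rewrite /GRing.comm -!cmorphM => ->. Qed.

Lemma gcomp_cmorph0 u k : gcomp u k = 0 -> gcomp (phi u) k = 0.
Proof. by case: phiP => f [fl _ ->] ->; exact: linear_zero. Qed.

Lemma cmorph_cseries a u : phi (cseries a u) = cseries a (phi u).
Proof.
case: phiP => f [fl fM fE]; apply: complP => k; rewrite fE /=.
have fD x y : f (x + y) = f x + f y by rewrite -[x]scale1r fl !scale1r.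
rewrite (big_morph _ fD (linear_zero fl)); apply: eq_bigr => i _.
by rewrite -cmorphX fE -[a i *: _]addr0 fl (linear_zero fl) addr0.
Qed.

Lemma cmorph_cexp u : phi (cexp u) = cexp (phi u).
Proof. exact: cmorph_cseries. Qed.

Lemma cmorph_cln u : phi (cln (1 + u)) = cln (1 + phi u).
Proof. by rewrite !cln1D cmorph_cseries. Qed.

Lemma cmorph_cder u : phi (cder u) = cder (phi u).
Proof.
case: phiP => f [fl fM fE]; apply: complP => k; rewrite gcomp_cder !fE gcomp_cder.
by rewrite -[_ *: gcomp u k]addr0 fl (linear_zero fl) addr0.
Qed.

End CompletedMorphism.

Lemma cmorph_comp (K : fieldType) (A B C : algType K) (GA : gradation A)
    (GB : gradation B) (GC : gradation C) (phi : compl GB -> compl GC)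
    (psi : compl GA -> compl GB) :
  cmorph phi -> cmorph psi -> cmorph (fun u => phi (psi u)).
Proof.
move=> [f [fl fM fE]] [g [gl gM gE]]; exists (fun x => f (g x)); split.
- by move=> c x y; rewrite gl fl.
- by split=> [|x y]; rewrite ?gM.1 ?fM.1 // gM.2 fM.2.
- by move=> u k; rewrite fE gE.
Qed.

(** * Algebra morphisms on tensor products and the embeddings of the factors *)

Section TensorMorphisms.
Variable K : fieldType.

(** Both sides of multiplicativity are bilinear, so pure tensors suffice. *)
Lemma tensor_monoid_morphism (A B C : algType K) (f : tensor A B -> C) :
    linear f -> f 1 = 1 ->
    (forall a b a' b', f (tens (a * a') (b * b')) = f (tens a b) * f (tens a' b')) ->
  monoid_morphism f.
Proof.
move=> fl f1 fM; split=> // s t; have f0 := linear_zero fl.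
elim/tens_ind: s => [|c a b s IH]; first by rewrite mul0r f0 mul0r.
rewrite mulrDl -scalerAl 2!fl IH mulrDl -scalerAl; congr (_ *: _ + _).
elim/tens_ind: t {s IH} => [|d a' b' t IH]; first by rewrite mulr0 f0 mulr0.
by rewrite mulrDr -scalerAr 2!fl IH mulrDr -scalerAr tensM fM.
Qed.

Lemma tmap_monoid_morphism (A A' B B' : algType K) (f : {linear A -> A'})
    (g : {linear B -> B'}) :
  monoid_morphism f -> monoid_morphism g -> monoid_morphism (tmap f g).
Proof.
move=> [f1 fM] [g1 gM]; apply: tensor_monoid_morphism; first exact: linearP.
  by rewrite -tens1 tmapE f1 g1.
by move=> a b a' b'; rewrite !tmapE fM gM tensM.
Qed.

Lemma tassoc_monoid_morphism (A B C : algType K) : monoid_morphism (@tassoc K A B C).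
Proof.
apply: tensor_monoid_morphism; [exact: linearP | exact: tassocE |].
move=> a s a' t.
(* Fixing the first factor exposes linearity in the second, which carries the two inductions over
   pure tensors. *)
pose ta a'' : tensor B C -> tensor (tensor A B) C := fun t => tassoc (tens a'' t).
have tl a'' : linear (ta a'') by move=> c x y; rewrite /ta tens_linearr linearP.
rewrite -!/(ta _ _); elim/tens_ind: s => [|c b e s IH].
  by rewrite mul0r !(linear_zero (tl _)) mul0r.
rewrite mulrDl -scalerAl 2!tl IH mulrDl -scalerAl; congr (_ *: _ + _).
elim/tens_ind: t {s IH} => [|d b' e' t IH]; first by rewrite mulr0 !(linear_zero (tl _)) mulr0.
rewrite mulrDr -scalerAr 2!tl IH mulrDr -scalerAr; congr (_ *: _ + _).
by rewrite /ta tensM !tassocE !tensM.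
Qed.

Lemma tunitl_monoid_morphism (A : algType K) : monoid_morphism (@tunitl K A).
Proof.
apply: tensor_monoid_morphism; [exact: linearP | by rewrite -tens1 tunitlE scale1r|].
by move=> c a c' a'; rewrite !tunitlE -scalerAl -scalerAr scalerA.
Qed.

Lemma tunitr_monoid_morphism (A : algType K) : monoid_morphism (@tunitr K A).
Proof.
apply: tensor_monoid_morphism; [exact: linearP | by rewrite -tens1 tunitrE scale1r|].
by move=> a c a' c'; rewrite !tunitrE -scalerAl -scalerAr scalerA.
Qed.

Variables (A B : algType K) (GA : gradation A) (GB : gradation B).

Definition tens_inl (a : A) : tensor A B := tens a 1.
Definition tens_inr (b : B) : tensor A B := tens 1 b.

Lemma tens_inl_linear : linear tens_inl. Proof. exact: tens_linearl. Qed.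
HB.instance Definition _ := GRing.isLinear.Build K A (tensor A B) _ tens_inl tens_inl_linear.

Lemma tens_inr_linear : linear tens_inr. Proof. exact: tens_linearr. Qed.
HB.instance Definition _ := GRing.isLinear.Build K B (tensor A B) _ tens_inr tens_inr_linear.

Lemma tens_inl_monoid_morphism : monoid_morphism tens_inl.
Proof. by split=> // a a'; rewrite /tens_inl tensM mulr1. Qed.

Lemma tens_inr_monoid_morphism : monoid_morphism tens_inr.
Proof. by split=> // b b'; rewrite /tens_inr tensM mulr1. Qed.

Lemma tens_inl_degree : degree_preserving GA (tens_gradation GA GB) tens_inl.
Proof. by move=> k a Ga; rewrite -[k]addn0; apply: tens_homog_tens => //; exact: homog1. Qed.

Lemma tens_inr_degree : degree_preserving GB (tens_gradation GA GB) tens_inr.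
Proof. by move=> k b Gb; rewrite -[k]add0n; apply: tens_homog_tens => //; exact: homog1. Qed.

Definition cinl : compl GA -> compl (tens_gradation GA GB) := cmap tens_inl_degree.
Definition cinr : compl GB -> compl (tens_gradation GA GB) := cmap tens_inr_degree.

Lemma cinlP : cmorph cinl. Proof. exact: cmorph_cmap tens_inl_monoid_morphism. Qed.
Lemma cinrP : cmorph cinr. Proof. exact: cmorph_cmap tens_inr_monoid_morphism. Qed.

(** Turns a tensor into an ordinary product of two commuting images, so that morphisms can be pushed
    through it. *)
Lemma ctensE u v : ctens u v = cinl u * cinr v.
Proof.
apply: complP => k; rewrite gcompM; apply: eq_bigr => i _ /=.
by rewrite /tens_inl /tens_inr tensM mulr1 mul1r.
Qed.

Lemma ctens1r u : ctens u 1 = cinl u.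
Proof. by rewrite ctensE (cmorph1 cinrP) mulr1. Qed.

Lemma ctens1l v : ctens 1 v = cinr v.
Proof. by rewrite ctensE (cmorph1 cinlP) mul1r. Qed.

Lemma comm_cinl_cinr u v : GRing.comm (cinl u) (cinr v).
Proof.
(* Reversing the summation index exchanges the roles of [i] and [k - i] in the Cauchy product. *)
rewrite /GRing.comm -ctensE; apply: complP => k; rewrite gcompM (reindex_inj rev_ord_inj) /=.
apply: eq_bigr => -[i ik] _ /=; rewrite /tens_inl /tens_inr tensM mulr1 mul1r subSS.
by rewrite subKn.
Qed.

Lemma tassoc_inl_inr (C : algType K) (a : A) (b : B) :
  tassoc (tens (1 : C) (tens_inl a + tens_inr b)) = tens (tens 1 a) 1 + tens (tens 1 1) b.
Proof. by rewrite -[tens_inl a]scale1r tens_linearr linearD linearZ /= !tassocE !scale1r. Qed.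

End TensorMorphisms.

Arguments cinl {K A B GA} GB u.
Arguments cinr {K A B} GA {GB} v.

(** * The cocycle equation *)

Lemma commrZ (K : fieldType) (A : algType K) (c : K) (x y : A) :
  GRing.comm x y -> GRing.comm x (c *: y).
Proof. by move=> e; rewrite /GRing.comm -scalerAl -scalerAr e. Qed.

Lemma mul_commCA (V : pzRingType) (x y t : V) : GRing.comm x y -> x * (y * t) = y * (x * t).
Proof. by move=> c; rewrite !mulrA c. Qed.

Section TwistEquation.
Variables (K : fieldType) (K0 : [pchar K] =i pred0).
Variables (U T : algType K) (GU : gradation U) (GT : gradation T).
(** The three tensor legs enter only as continuous morphisms with commuting images, which reduces
    the cocycle equation to a computation in one algebra. *)
Variables i1 i2 i3 : compl GU -> compl GT.
Hypotheses (i1P : cmorph i1) (i2P : cmorph i2) (i3P : cmorph i3).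
Hypothesis c12 : forall u v, GRing.comm (i1 u) (i2 v).
Hypothesis c13 : forall u v, GRing.comm (i1 u) (i3 v).
Hypothesis c23 : forall u v, GRing.comm (i2 u) (i3 v).
Variables (alpha beta gamma : K) (H A B E : compl GU).
Hypotheses (B0 : gcomp B 0 = 0) (E0 : gcomp E 0 = 0).
Hypothesis cderE : cder E = 2 *: E.
Hypothesis ab : alpha + beta = 2.
Hypothesis HE : H * E = E * H + 2 *: E.
Hypothesis HA : H * A = A * H + alpha *: A.
Hypothesis HB : H * B = B * H + beta *: B.
Hypotheses (EA : GRing.comm E A) (EB : GRing.comm E B).
Hypothesis AB : A * B = B * A + gamma *: E.

Let sigma : compl GU := 2^-1 *: cln (1 + gamma *: E).
Let z : compl GU := cexp (- 2 *: sigma).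
(** This is the coproduct of [gamma *: E] in legs 2 and 3, so [1 + E23] is Delta(x). *)
Let E23 : compl GT := gamma *: (i2 E + i3 E).
Let s : compl GT := 2^-1 *: cln (1 + E23).
Let q : compl GT := cexp (- 2 *: s).

Let two_neq0 : (2 : K) != 0.
Proof. by have /pcharf0P -> := K0. Qed.

Let gE0 : gcomp (gamma *: E) 0 = 0. Proof. by rewrite gcompZ E0 scaler0. Qed.
Let sigma0 : gcomp sigma 0 = 0. Proof. by rewrite gcompZ gcomp_cln0 scaler0. Qed.
Let E23_0 : gcomp E23 0 = 0.
Proof.
by rewrite gcompZ gcompD (gcomp_cmorph0 i2P E0) (gcomp_cmorph0 i3P E0) addr0 scaler0.
Qed.
Let s0 : gcomp s 0 = 0. Proof. by rewrite gcompZ gcomp_cln0 scaler0. Qed.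

Let comm_sigma w : GRing.comm w E -> GRing.comm w sigma.
Proof. by move=> c; apply/commrZ/comm_cln => //; exact: commrZ. Qed.

Let comm_z w : GRing.comm w E -> GRing.comm w z.
Proof.
move=> c; apply: comm_cexp; last exact/commrZ/comm_sigma.
by rewrite gcompZ sigma0 scaler0.
Qed.

Let comm_s w : GRing.comm w (i2 E) -> GRing.comm w (i3 E) -> GRing.comm w s.
Proof. by move=> c2 c3; apply/commrZ/comm_cln => //; exact/commrZ/commrD. Qed.

Let comm_q w : GRing.comm w (i2 E) -> GRing.comm w (i3 E) -> GRing.comm w q.
Proof.
move=> c2 c3; apply: comm_cexp; last exact/commrZ/comm_s.
by rewrite gcompZ s0 scaler0.
Qed.

Let cEE : GRing.comm E E. Proof. by []. Qed.
Let cEs : GRing.comm E sigma. Proof. exact: comm_sigma. Qed.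
Let cEz : GRing.comm E z. Proof. exact: comm_z. Qed.

Let n2s : gcomp (i2 sigma) 0 = 0. Proof. exact: gcomp_cmorph0. Qed.
Let n3s : gcomp (i3 sigma) 0 = 0. Proof. exact: gcomp_cmorph0. Qed.
Let n2B : gcomp (i2 B) 0 = 0. Proof. exact: gcomp_cmorph0. Qed.
Let n3B : gcomp (i3 B) 0 = 0. Proof. exact: gcomp_cmorph0. Qed.
Let n2y : gcomp (i2 (B * z)) 0 = 0. Proof. by rewrite gcomp_cmorph0 // gcompM0 B0 mul0r. Qed.
Let n3y : gcomp (i3 (B * z)) 0 = 0. Proof. by rewrite gcomp_cmorph0 // gcompM0 B0 mul0r. Qed.

(* With z = e^{-2 sigma} and x = 1 + gamma E: Jab and Xab are the factors
   exp(H (x) sigma) and exp(A (x) B z) placed in legs a, b; s and q stand for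
   Delta(sigma) and Delta(z) in legs 2, 3. *)
Let J12 := cexp (i1 H * i2 sigma).
Let J13 := cexp (i1 H * i3 sigma).
Let J23 := cexp (i2 H * i3 sigma).
Let X12 := cexp (i1 A * i2 (B * z)).
Let X13 := cexp (i1 A * i3 (B * z)).
Let X23 := cexp (i2 A * i3 (B * z)).
Let e3 c := cexp (c *: i3 sigma).

Ltac zero := by rewrite ?(s0, n2s, n3s, n2y, n3y, n2B, n3B, mul0r, mulr0, scaler0, addr0, gcompD, gcompZ, gcompM0).

(** Reduces commutation of composites to their factors: distinct legs commute by [c12], [c13],
    [c23], and inside a leg what is not reflexive comes from [E] commuting with [A] and [B]. *)
Ltac comm := match goal with
  | |- _ = _ => apply: commr_sym; comm
  | |- GRing.comm ?x ?x => reflexivity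
  | |- GRing.comm _ (_ + _) => apply: commrD; comm
  | |- GRing.comm _ (_ * _) => apply: commrM; comm
  | |- GRing.comm _ (_ *: _) => apply: commrZ; comm
  | |- GRing.comm _ (cexp _) => apply: comm_cexp; [zero | comm]
  | |- GRing.comm _ s => apply: comm_s; comm
  | |- GRing.comm _ q => apply: comm_q; comm
  | |- GRing.comm _ 1 => exact: commr1
  | |- GRing.comm (_ + _) _ => apply: commr_sym; comm
  | |- GRing.comm (_ * _) _ => apply: commr_sym; comm
  | |- GRing.comm (_ *: _) _ => apply: commr_sym; comm
  | |- GRing.comm (cexp _) _ => apply: commr_sym; comm
  | |- GRing.comm s _ => apply: commr_sym; comm
  | |- GRing.comm q _ => apply: commr_sym; comm
  | |- GRing.comm (i1 _) (i2 _) => exact: c12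
  | |- GRing.comm (i1 _) (i3 _) => exact: c13
  | |- GRing.comm (i2 _) (i3 _) => exact: c23
  | |- GRing.comm (i2 _) (i1 _) => exact/commr_sym/c12
  | |- GRing.comm (i3 _) (i1 _) => exact/commr_sym/c13
  | |- GRing.comm (i3 _) (i2 _) => exact/commr_sym/c23
  | |- GRing.comm (i2 _) (i2 _) => apply: (cmorph_comm i2P); comm
  | |- GRing.comm (i3 _) (i3 _) => apply: (cmorph_comm i3P); comm
  | |- GRing.comm _ sigma => apply: comm_sigma; comm
  | |- GRing.comm sigma _ => apply: commr_sym; apply: comm_sigma; comm
  | |- GRing.comm _ z => apply: comm_z; comm
  | |- GRing.comm z _ => apply: commr_sym; apply: comm_z; comm
  | |- GRing.comm _ (e3 _) => rewrite /e3; comm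
  | |- GRing.comm (e3 _) _ => rewrite /e3; comm
  | |- GRing.comm _ ?x => unfold x; comm
  | |- GRing.comm ?x _ => unfold x; comm
  | |- GRing.comm _ _ => first [assumption | apply: commr_sym; assumption]
  end.

(** [cexp_cln] applies because [E] is homogeneous: its derivative is a multiple of [E] and so
    commutes with it. *)
Lemma exp2sigma : cexp (2 *: sigma) = 1 + gamma *: E.
Proof.
rewrite /sigma scalerA divff // scale1r cexp_cln // cderZ cderE.
by do 2!apply: commrZ; apply/commr_sym/commrZ.
Qed.

Lemma mulz_x : z * (1 + gamma *: E) = 1.
Proof.
rewrite -exp2sigma /z -[X in _ * cexp X]opprK -scaleNr.
by rewrite cexpNr // gcompZ sigma0 scaler0.
Qed.

Lemma mulq_x : q * (1 + E23) = 1.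
Proof.
have <- : cexp (2 *: s) = 1 + E23.
  rewrite /s scalerA divff // scale1r cexp_cln // /E23 cderZ cderD.
  rewrite -(cmorph_cder i2P) -(cmorph_cder i3P) cderE (cmorphZ i2P) (cmorphZ i3P).
  by comm.
rewrite /q -[X in _ * cexp X]opprK -scaleNr.
by rewrite cexpNr // gcompZ s0 scaler0.
Qed.

Lemma i3x : e3 2 = 1 + gamma *: i3 E.
Proof.
have := congr1 i3 exp2sigma.
by rewrite (cmorph_cexp i3P) (cmorphD i3P) (cmorph1 i3P) (cmorphZ i3P 2) (cmorphZ i3P gamma).
Qed.

(** [E], [B] and [A] are weight vectors for [H], so moving exp(H (x) sigma) past one of them
    produces the exponential of the weight times sigma in the other leg. The next two lemmas follow
    the same pattern. *)
Lemma J23_E : J23 * i2 E = i2 E * (J23 * e3 2).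
Proof.
apply: (cexp_eigen K0) => //; [zero | zero | comm | ].
rewrite -mulrA -(c23 E sigma) mulrA -(cmorphM i2P) HE (cmorphD i2P) (cmorphM i2P) (cmorphZ i2P).
by rewrite mulrDl mulrDr -scalerAl -scalerAr mulrA.
Qed.

Lemma J23_B : J23 * i2 B = i2 B * (J23 * e3 beta).
Proof.
apply: (cexp_eigen K0) => //; [zero | zero | comm | ].
rewrite -mulrA -(c23 B sigma) mulrA -(cmorphM i2P) HB (cmorphD i2P) (cmorphM i2P) (cmorphZ i2P).
by rewrite mulrDl mulrDr -scalerAl -scalerAr mulrA.
Qed.

Lemma J13_A : J13 * i1 A = i1 A * (J13 * e3 alpha).
Proof.
apply: (cexp_eigen K0) => //; [zero | zero | comm | ].
rewrite -mulrA -(c13 A sigma) mulrA -(cmorphM i1P) HA (cmorphD i1P) (cmorphM i1P) (cmorphZ i1P).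
by rewrite mulrDl mulrDr -scalerAl -scalerAr mulrA.
Qed.

Lemma J23_s : J23 * s = (i2 sigma + i3 sigma) * J23.
Proof.
(* [1 + w] is the product x_2 x_3: the factor x_3 that [E] in leg 2 acquires by [J23_E] supplies the
   cross term missing from [E23]. *)
pose w := gamma *: i2 E + gamma *: i3 E + gamma *: i2 E * (gamma *: i3 E).
have g20 : gcomp (gamma *: i2 E) 0 = 0 by rewrite gcompZ (gcomp_cmorph0 i2P E0) scaler0.
have g30 : gcomp (gamma *: i3 E) 0 = 0 by rewrite gcompZ (gcomp_cmorph0 i3P E0) scaler0.
have w0 : gcomp w 0 = 0 by rewrite !gcompD gcompM0 g20 g30 mul0r !addr0.
have e : J23 * (1 + E23) = (1 + w) * J23.
  rewrite -mul1D1D -i3x mulrDr mulr1 /E23 -scalerAr mulrDr J23_E.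
  have -> : J23 * i3 E = i3 E * J23 by comm.
  have -> : J23 * e3 2 = e3 2 * J23 by comm.
  rewrite [in RHS](mulrDl 1 (gamma *: i2 E)) mul1r [X in _ = (X + _) * _]i3x !mulrDl mul1r -!scalerAl.
  by rewrite scalerDr -!addrA [X in _ + X]addrC !mulrA.
rewrite -scalerAr (cln_intertwine E23_0 w0 e) scalerAl; congr (_ * _).
have d2 : cder (gamma *: i2 E) = gamma *: (2 *: i2 E).
  by rewrite cderZ -(cmorph_cder i2P) cderE (cmorphZ i2P).
have d3 : cder (gamma *: i3 E) = gamma *: (2 *: i3 E).
  by rewrite cderZ -(cmorph_cder i3P) cderE (cmorphZ i3P).
rewrite cln_mul1D1D // ?d2 ?d3; try comm.
by rewrite scalerDr /sigma (cmorphZ i2P) (cmorphZ i3P) (cmorph_cln i2P) (cmorph_cln i3P) (cmorphZ i2P) (cmorphZ i3P).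
Qed.

Lemma J23_q : J23 * q = i2 z * i3 z * J23.
Proof.
rewrite /z !(cmorph_cexp i2P, cmorph_cexp i3P) (cmorphZ i2P (-2)) (cmorphZ i3P (-2)).
rewrite -(cexpD K0); [|zero|zero|comm] => //.
apply: cseries_intertwine; [zero|zero|].
by rewrite -scalerDr -scalerAr J23_s scalerAl.
Qed.

Lemma J23_expHs : J23 * cexp (i1 H * s) = J12 * J13 * J23.
Proof.
rewrite /J12 /J13 -(cexpD K0); [|zero|zero|comm] => //.
apply: cseries_intertwine; [zero|zero|].
rewrite (mul_commCA (y := i1 H)); last by comm.
by rewrite J23_s mulrA mulrDr.
Qed.

(* The weights alpha + beta = 2 produce a factor x_3, which cancels the z_3 of
   J23 q = z_2 z_3 J23. *)
Lemma AB_J : i1 A * i2 (B * z) * (J13 * J23) = J13 * J23 * (i1 A * (i2 B * q)).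
Proof.
rewrite (cmorphM i2P) -!mulrA.
rewrite [in RHS](mul_commCA (x := J23)); last by comm.
rewrite [in RHS](mulrA J23) J23_B [RHS]mulrA J13_A -!mulrA; congr (_ * _).
rewrite (mul_commCA (x := e3 alpha)); last by comm.
rewrite (mul_commCA (x := J13)); last by comm.
congr (_ * _).
rewrite (mul_commCA (x := e3 alpha)); last by comm.
have ea : e3 alpha * e3 beta = e3 2.
  by rewrite -(cexpD K0); [rewrite -scalerDl ab|zero|zero|comm].
have -> : e3 alpha * (e3 beta * q) = q * e3 2 by rewrite mulrA ea; comm.
rewrite (mulrA J23) J23_q -!mulrA.
have -> : J23 * e3 2 = e3 2 * J23 by comm.
have -> : i3 z * (e3 2 * J23) = J23.
  by rewrite mulrA i3x -(cmorph1 i3P) -(cmorphZ i3P) -(cmorphD i3P) -(cmorphM i3P) mulz_x (cmorph1 i3P) mul1r.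
by rewrite mul_commCA //; comm.
Qed.

(** The commutator of the exponent with B_2 is a multiple of E_2 B_3 z_3, which commutes with the
    exponent, so [cexp_shift] gives a single correction term. *)
Lemma X23_B : X23 * i2 B = (i2 B + gamma *: (i2 E * i3 (B * z))) * X23.
Proof.
apply: (cexp_shift K0) => //; [zero | comm |].
rewrite -mulrA -(c23 B (B * z)) mulrA -(cmorphM i2P) AB (cmorphD i2P) (cmorphM i2P) (cmorphZ i2P).
by rewrite mulrDl -scalerAl mulrA.
Qed.

Lemma X23_ABq :
  X23 * (i1 A * ((i2 B + i3 B) * q)) = (i1 A * (i2 B * q) + i1 A * i3 (B * z)) * X23.
Proof.
rewrite (mul_commCA (x := X23)); last by comm.
rewrite -mulrDr -mulrA; congr (_ * _).
rewrite mulrA mulrDr X23_B.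
have -> : X23 * i3 B = i3 B * X23 by comm.
have -> : forall t, (t * X23 + i3 B * X23) * q = (t + i3 B) * q * X23.
  by move=> t; rewrite -mulrDl -!mulrA; congr (_ * _); apply: commr_sym; comm.
congr (_ * _); rewrite -addrA [LHS]mulrDl; congr (_ + _).
rewrite (cmorphM i3P).
(* Since z_3 x_3 = 1, B_3 equals B_3 z_3 x_3, and the two terms combine to B_3 z_3 Delta(x); the
   last factor then cancels against [q]. *)
have -> : gamma *: (i2 E * (i3 B * i3 z)) + i3 B = i3 B * i3 z * (1 + E23).
  have e : i3 z * (1 + gamma *: i3 E) = 1.
    by rewrite -(cmorph1 i3P) -(cmorphZ i3P) -(cmorphD i3P) -(cmorphM i3P) mulz_x.
  rewrite /E23 scalerDr addrCA mulrDr -[X in _ = _ + X]mulrA e mulr1; congr (_ + _).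
  by rewrite -scalerAr; congr (_ *: _); comm.
rewrite -mulrA; have -> : (1 + E23) * q = q * (1 + E23) by comm.
by rewrite mulq_x mulr1.
Qed.

Lemma twist_equation :
  J12 * X12 * (cexp ((i1 H + i2 H) * i3 sigma) * cexp ((i1 A + i2 A) * i3 (B * z))) =
  J23 * X23 * (cexp (i1 H * s) * cexp (i1 A * ((i2 B + i3 B) * q))).
Proof.
rewrite (mulrDl (i1 H)) (mulrDl (i1 A)) [cexp (_ + _)](cexpD K0) -/J13 -/J23; [|zero|zero|comm] => //.
rewrite [cexp (_ + _)](cexpD K0) -/X13 -/X23; [|zero|zero|comm] => //.
(* [X23] commutes with the exponential of [i1 H * s], as [s] involves only [E]; the two pairs can
   then be conjugated separately. *)
have -> : J23 * X23 * (cexp (i1 H * s) * cexp (i1 A * ((i2 B + i3 B) * q))) =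
  J23 * cexp (i1 H * s) * (X23 * cexp (i1 A * ((i2 B + i3 B) * q))).
  by rewrite -!mulrA; congr (_ * _); apply: mul_commCA; comm.
rewrite J23_expHs.
have -> : X23 * cexp (i1 A * ((i2 B + i3 B) * q)) =
    cexp (i1 A * (i2 B * q)) * X13 * X23.
  rewrite /X13 -(cexpD K0) => //; [|zero|zero|comm].
  apply: cseries_intertwine; [zero| |exact: X23_ABq].
  by rewrite gcompD [X in _ + X]gcompM0_r // addr0; zero.
(* What remains is to carry [X12] through [J13 * J23], which is [AB_J] exponentiated. *)
have e : X12 * (J13 * J23) = J13 * J23 * cexp (i1 A * (i2 B * q)).
  by apply/esym/cseries_intertwine; [zero | zero | rewrite AB_J].
by rewrite -!mulrA; congr (_ * _); rewrite !mulrA -(mulrA X12) e !mulrA.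
Qed.

End TwistEquation.

(** * The twist *)

Section EnvelopingMorphisms.
Variables (K : fieldType) (L : lieType K) (LG : nat -> L -> Prop).
Local Notation U := (Uenv L).
Local Notation G1 := (uenv_gradation LG).
Local Notation G2 := (tens_gradation G1 G1).

Lemma cassocP : cmorph (@cassoc K L LG).
Proof.
exact: (@cmorph_cmap K _ _ _ _ _ (@tassoc_degree K U U U G1 G1 G1)
  (tassoc_monoid_morphism U U U)).
Qed.

Lemma coproduct_idP : cmorph (@coproduct_id K L LG).
Proof.
by apply: cmorph_cmap; apply: tmap_monoid_morphism => //; exact: coproduct_monoid.
Qed.

Lemma id_coproductP : cmorph (@id_coproduct K L LG).
Proof.
apply: cmorph_comp; first exact: cassocP.
by apply: cmorph_cmap; apply: tmap_monoid_morphism => //; exact: coproduct_monoid.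
Qed.

Lemma counit_idP : cmorph (@counit_id K L LG).
Proof.
apply: cmorph_comp; first exact: cmorph_cmap (@tunitl_monoid_morphism _ _).
by apply: cmorph_cmap; apply: tmap_monoid_morphism => //; exact: counit_monoid.
Qed.

Lemma id_counitP : cmorph (@id_counit K L LG).
Proof.
apply: cmorph_comp; first exact: cmorph_cmap (@tunitr_monoid_morphism _ _).
by apply: cmorph_cmap; apply: tmap_monoid_morphism => //; exact: counit_monoid.
Qed.

Definition cleg1 (u : compl G1) : compl (tens_gradation G2 G1) := cinl G1 (cinl G1 u).
Definition cleg2 (u : compl G1) : compl (tens_gradation G2 G1) := cinl G1 (cinr G1 u).
Definition cleg3 (u : compl G1) : compl (tens_gradation G2 G1) := cinr G2 u.

Lemma cleg1P : cmorph cleg1. Proof. apply: cmorph_comp; exact: cinlP. Qed.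
Lemma cleg2P : cmorph cleg2. Proof. by apply: cmorph_comp; [exact: cinlP | exact: cinrP]. Qed.
Lemma cleg3P : cmorph cleg3. Proof. exact: cinrP. Qed.

Lemma cassoc_cinr_cinl u : cassoc (cinr G1 (cinl G1 u)) = cleg2 u.
Proof. by apply: complP => k; rewrite /= tassocE. Qed.

Lemma cassoc_cinr_cinr u : cassoc (cinr G1 (cinr G1 u)) = cleg3 u.
Proof. by apply: complP => k; rewrite /= tassocE. Qed.

Lemma coproduct_id_cinr u : coproduct_id (cinr G1 u) = cleg3 u.
Proof. by apply: complP => k; rewrite /= tmapE rmorph1. Qed.

Lemma id_coproduct_cinl u : id_coproduct (cinl G1 u) = cleg1 u.
Proof. by apply: complP => k; rewrite /= tmapE rmorph1 -tens1 tassocE. Qed.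

Section Primitive.
Variables (x : L) (d : nat) (Gx : G1 d (uinj x)).

(** A component is either [uinj x] or 0, and the coproduct is primitive on both. *)
Lemma coproduct_gcomp_chomog k : coproduct (gcomp (chomog Gx) k) =
  tens_inl U (gcomp (chomog Gx) k) + tens_inr U (gcomp (chomog Gx) k).
Proof. by rewrite /=; case: eqP => _; rewrite ?coproduct_inj // !linear0 addr0. Qed.

Lemma counit_gcomp_chomog k : counit (gcomp (chomog Gx) k) = 0.
Proof. by rewrite /=; case: eqP => _; rewrite ?counit_inj // linear0. Qed.

Lemma coproduct_id_cinl_chomog :
  coproduct_id (cinl G1 (chomog Gx)) = cleg1 (chomog Gx) + cleg2 (chomog Gx).
Proof.
apply: complP => k; rewrite gcompD [LHS]tmapE [X in tens X _]coproduct_gcomp_chomog.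
exact: linearD (tens_inl U) _ _.
Qed.

Lemma id_coproduct_cinr_chomog :
  id_coproduct (cinr G1 (chomog Gx)) = cleg2 (chomog Gx) + cleg3 (chomog Gx).
Proof.
apply: complP => k; rewrite gcompD /id_coproduct.
transitivity (tassoc (tens (1 : U) (coproduct (gcomp (chomog Gx) k)))).
  by rewrite /= tmapE.
by rewrite coproduct_gcomp_chomog; exact: tassoc_inl_inr.
Qed.

Lemma counit_id_cinl_chomog : counit_id (cinl G1 (chomog Gx)) = 0.
Proof.
apply: complP => k; rewrite [LHS](congr1 _ (tmapE _ _ _ _)) [LHS]tunitlE.
by rewrite [X in X *: _]counit_gcomp_chomog scale0r.
Qed.

Lemma id_counit_cinr_chomog : id_counit (cinr G1 (chomog Gx)) = 0.
Proof.
apply: complP => k; rewrite [LHS](congr1 _ (tmapE _ _ _ _)) [LHS]tunitrE.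
by rewrite [X in X *: _]counit_gcomp_chomog scale0r.
Qed.

End Primitive.
End EnvelopingMorphisms.

(** * Invertibility, counit conditions and cocycle equation *)

Section Twist.
Variables (K : fieldType) (K0 : [pchar K] =i pred0) (L : finLieType K).
Variables (alpha beta gamma : K) (H A B E : L).
Hypotheses (sum_alpha_beta : alpha + beta = 2) (lieHE : lie H E = 2 *: E)
  (lieHA : lie H A = alpha *: A) (lieHB : lie H B = beta *: B)
  (lieEA : lie E A = 0) (lieEB : lie E B = 0) (lieAB : lie A B = gamma *: E).

Let G1 := gradU H A B E.
Let sigma : compl G1 := 2^-1 *: cln (1 + gamma *: cE H A B E).
Let z : compl G1 := cexp (- 2 *: sigma).
Let F := cexp (ctens (cH H A B E) sigma) * cexp (ctens (cA H A B E) (cB H A B E * z)).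

Lemma cE0 : gcomp (cE H A B E) 0 = 0. Proof. by []. Qed.
Lemma cB0 : gcomp (cB H A B E) 0 = 0. Proof. by []. Qed.

Let sigma0 : gcomp sigma 0 = 0. Proof. by rewrite gcompZ gcomp_cln0 scaler0. Qed.
Let Bz0 : gcomp (cB H A B E * z) 0 = 0. Proof. by rewrite gcompM0 cB0 mul0r. Qed.

Let FE : F = cexp (cinl G1 (cH H A B E) * cinr G1 sigma) *
             cexp (cinl G1 (cA H A B E) * cinr G1 (cB H A B E * z)).
Proof. by rewrite /F !ctensE. Qed.

Let cexp_unit (u : compl (tens_gradation G1 G1)) : gcomp u 0 = 0 ->
  cexp u * cexp (- u) = 1 /\ cexp (- u) * cexp u = 1.
Proof.
move=> u0; split; first exact: cexpNr.
by rewrite -[X in _ * cexp X]opprK cexpNr // -scaleN1r gcompZ u0 scaler0.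
Qed.

Lemma twist_invertible : exists F', F * F' = 1 /\ F' * F = 1.
Proof.
rewrite FE; set u := cinl _ _ * cinr _ _; set v := cinl _ _ * cinr _ _.
have [uV Vu] : cexp u * cexp (- u) = 1 /\ cexp (- u) * cexp u = 1.
  by apply/cexp_unit/gcompM0_r/(gcomp_cmorph0 (cinrP _ _)).
have [vV Vv] : cexp v * cexp (- v) = 1 /\ cexp (- v) * cexp v = 1.
  by apply/cexp_unit/gcompM0_r/(gcomp_cmorph0 (cinrP _ _)).
exists (cexp (- v) * cexp (- u)); split.
  by rewrite mulrA -(mulrA (cexp u)) vV mulr1.
by rewrite mulrA -(mulrA (cexp (- v))) Vu mulr1.
Qed.

(** The counit kills [H] and [A], the first factors of the two exponents. *)
Lemma counit_id_twist : counit_id F = 1.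
Proof.
have P := @counit_idP _ _ (fun d x => x \in Lhomog H A B E d).
rewrite FE (cmorphM P) !(cmorph_cexp P) !(cmorphM P) !counit_id_cinl_chomog.
by rewrite !mul0r !cexp0 mulr1.
Qed.

(** The counit kills [B], and it kills sigma because it sends [1 + gamma *: E] to 1, whose logarithm
    is 0. *)
Lemma id_counit_twist : id_counit F = 1.
Proof.
have P := @id_counitP _ _ (fun d x => x \in Lhomog H A B E d).
have R := cinrP G1 G1.
have s0 : id_counit (cinr G1 sigma) = 0.
  rewrite /sigma (cmorphZ R) (cmorph_cln R) (cmorphZ R) (cmorphZ P) (cmorph_cln P) (cmorphZ P).
  by rewrite id_counit_cinr_chomog scaler0 addr0 cln1 scaler0.
have b0 : id_counit (cinr G1 (cB H A B E * z)) = 0.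
  by rewrite (cmorphM R) (cmorphM P) id_counit_cinr_chomog mul0r.
rewrite FE (cmorphM P) !(cmorph_cexp P) !(cmorphM P) s0 b0.
by rewrite !mulr0 !cexp0 mulr1.
Qed.

(** All maps involved are continuous morphisms, so they pass through exp and ln down to the
    generators, where the coproduct is primitive; the result is an instance of [twist_equation]. *)
Lemma twist_cocycle :
  (ctens F 1 : compl (tens_gradation (tens_gradation G1 G1) G1)) * coproduct_id F =
  cassoc (ctens 1 F) * id_coproduct F.
Proof.
pose LG (d : nat) (x : L) : Prop := x \in Lhomog H A B E d.
have Lf := cinlP (tens_gradation G1 G1) G1.
have P2 : cmorph (fun u => cassoc (cinr G1 u)) := cmorph_comp (@cassocP _ _ LG) (cinrP _ _).
have D1 := @coproduct_idP _ _ LG; have D2 := @id_coproductP _ _ LG.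
have R := cinrP G1 G1.
rewrite ctens1r ctens1l FE.
rewrite (cmorphM Lf) !(cmorph_cexp Lf) !(cmorphM Lf).
rewrite (cmorphM P2) !(cmorph_cexp P2) !(cmorphM P2).
rewrite (cmorphM D1) !(cmorph_cexp D1) !(cmorphM D1).
rewrite (cmorphM D2) !(cmorph_cexp D2) !(cmorphM D2).
rewrite !cassoc_cinr_cinl !cassoc_cinr_cinr !coproduct_id_cinr !id_coproduct_cinl.
rewrite !coproduct_id_cinl_chomog.
have eE : id_coproduct (cinr G1 (cE H A B E)) = cleg2 (cE H A B E) + cleg3 (cE H A B E).
  exact: id_coproduct_cinr_chomog.
have eB : id_coproduct (cinr G1 (cB H A B E)) = cleg2 (cB H A B E) + cleg3 (cB H A B E).
  exact: id_coproduct_cinr_chomog.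
(* Sigma is not homogeneous, so its coproduct is computed inside the logarithm, from that of [E]. *)
have es : id_coproduct (cinr G1 sigma) =
    2^-1 *: cln (1 + gamma *: (cleg2 (cE H A B E) + cleg3 (cE H A B E))).
  by rewrite /sigma (cmorphZ R) (cmorph_cln R) (cmorphZ R) (cmorphZ D2) (cmorph_cln D2) (cmorphZ D2) eE.
have ey : id_coproduct (cinr G1 (cB H A B E * z)) =
    (cleg2 (cB H A B E) + cleg3 (cB H A B E)) *
    cexp (- 2 *: (2^-1 *: cln (1 + gamma *: (cleg2 (cE H A B E) + cleg3 (cE H A B E))))).
  rewrite (cmorphM R) (cmorphM D2) eB /z (cmorph_cexp R) (cmorph_cexp D2).
  by rewrite (cmorphZ R (-2)) (cmorphZ D2 (-2)) es.
rewrite ey es.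
apply: (@twist_equation _ K0 _ _ _ _ _ _ _ (@cleg1P _ _ LG) (@cleg2P _ _ LG) (@cleg3P _ _ LG)
  _ _ _ alpha beta gamma (cH H A B E) (cA H A B E) (cB H A B E) (cE H A B E) cB0 cE0).
- by move=> u v; apply: (cmorph_comm Lf); exact: comm_cinl_cinr.
- by move=> u v; exact: comm_cinl_cinr.
- by move=> u v; exact: comm_cinl_cinr.
(* The factor 2 is the degree of [E]. *)
- exact: cder_chomog.
- by [].
- by apply: chomog_bracket => //; rewrite -uinj_lie lieHE linearZ.
- by apply: chomog_bracket => //; rewrite -uinj_lie lieHA linearZ.
- by apply: chomog_bracket => //; rewrite -uinj_lie lieHB linearZ.
- by apply: chomog_comm; rewrite -uinj_lie lieEA linear0.
- by apply: chomog_comm; rewrite -uinj_lie lieEB linear0.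
- by apply: chomog_bracket => //; rewrite -uinj_lie lieAB linearZ.
Qed.

Lemma twistP : is_twist F.
Proof.
split; [exact: twist_invertible | exact: twist_cocycle | exact: counit_id_twist |].
exact: id_counit_twist.
Qed.

End Twist.

Unset Implicit Arguments.

Theorem mainTheorem1 (R : realType) (L : finLieType R[i])
    (alpha beta gamma : R[i]) (H A B E : L)
    (basisL : basis_of fullv [:: H; A; B; E])
    (sum_alpha_beta : alpha + beta = 2)
    (lieHE : lie H E = 2 *: E)
    (lieHA : lie H A = alpha *: A)
    (lieHB : lie H B = beta *: B)
    (lieEA : lie E A = 0)
    (lieEB : lie E B = 0)
    (lieAB : lie A B = gamma *: E) :
  let sigma : compl (gradU H A B E) :=
    2^-1 *: cln (1 + gamma *: cE H A B E) in
  is_twist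
    (cexp (ctens (cH H A B E) sigma) *
     cexp (ctens (cA H A B E) (cB H A B E * cexp (- 2 *: sigma)))).
Proof.
(* [pchar_num] supplies characteristic 0 for the complex field [R[i]]. *)
exact: (twistP (Num.Theory.pchar_num _) sum_alpha_beta lieHE lieHA lieHB lieEA lieEB lieAB).
Qed.
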